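(* Consider a Markov decision process with state space $\mathbb{X}$, action space $\mathbb{A}$, one-step cost $c$ and transition kernel $q$, satisfying Assumptions W* and B (as defined in the context). Let $\{\alpha_n\}_{n\ge 1}\subset[0,1)$ be a sequence of discount factors with $\alpha_n\uparrow 1$ such that: (i) the sequence of functions $\{u_{\alpha_n}\}_{n\ge 1}$ is lower semi-equicontinuous on $\mathbb{X}$; (ii) $\lim_{n\to\infty} u_{\alpha_n}(x)$ exists for each $x\in\mathbb{X}$; (iii) for each $x\in\mathbb{X}$ and $a\in\mathbb{A}$ the sequence $\{u_{\alpha_n}\}_{n\ge 1}$ is asymptotically uniformly integrable with respect to $q(\cdot|x,a)$. Let $u(x):=\liminf_{n\to\infty}u_{\alpha_n}(x)$, $x\in\mathbb{X}$. Then there exists a stationary policy $\phi$ such that for all $x\in\mathbb{X}$ $$w^*+u(x)=c(x,\phi(x))+\int_{\mathbb{X}}u(y)\,q(dy|x,\phi(x))=\min_{a\in\mathbb{A}}\Big[c(x,a)+\int_{\mathbb{X}}u(y)\,q(dy|x,a)\Big].$$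
   Context: MDP. $\mathbb{X}$ and $\mathbb{A}$ are Borel subsets of Polish spaces; $c:\mathbb{X}\times\mathbb{A}\to[-\infty,+\infty]$ is measurable and bounded below (the value $+\infty$ is allowed); $q(B|x,a)$ is a (regular, measurable) transition probability from $\mathbb{X}\times\mathbb{A}$ to $\mathbb{X}$. Every action in $\mathbb{A}$ is available at every state. Histories: $H_t=(\mathbb{X}\times\mathbb{A})^t\times\mathbb{X}$. A policy $\pi=(\pi_0,\pi_1,\dots)$ is a sequence of regular transition probabilities $\pi_t(\cdot|h_t)$ from $H_t$ to $\mathbb{A}$; $\Pi$ is the set of all policies. A stationary policy is a non-randomized policy whose decisions depend only on the current state; it is identified with a measurable function $\phi:\mathbb{X}\to\mathbb{A}$. An initial state $x$ and a policy $\pi$ define, by the Ionescu Tulcea theorem, a unique probability on $(\mathbb{X}\times\mathbb{A})^\infty$ with expectation $\mathbb{E}_x^\pi$. Costs. $v_{N,\alpha}^\pi(x)=\mathbb{E}_x^\pi\sum_{t=0}^{N-1}\alpha^t c(x_t,a_t)$; for $\alpha\in[0,1)$, $v_\alpha^\pi(x)$ is the same with $N=\infty$, and $v_\alpha(x)=\inf_{\pi\in\Pi}v_\alpha^\pi(x)$. Average cost: $w_1^\pi(x)=\limsup_{N\to\infty}\frac1N v_{N,1}^\pi(x)$, $w_1(x)=\inf_{\pi\in\Pi}w_1^\pi(x)$, $w^*=\inf_{x\in\mathbb{X}}w_1(x)$. Set $m_\alpha=\inf_{x\in\mathbb{X}}v_\alpha(x)$ and $u_\alpha(x)=v_\alpha(x)-m_\alpha$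 (well defined under Assumption B(i), which implies $m_\alpha<+\infty$). Assumption W*: (i) $c$ is $\mathbb{K}$-inf-compact, i.e. for every nonempty compact $\mathcal{K}\subset\mathbb{X}$ and every $\lambda\in\mathbb{R}$ the set $\{(x,a)\in\mathcal{K}\times\mathbb{A}: c(x,a)\le\lambda\}$ is compact; (ii) $q(\cdot|x,a)$ is weakly continuous in $(x,a)\in\mathbb{X}\times\mathbb{A}$, i.e. $(x_n,a_n)\to(x,a)$ implies that $q(\cdot|x_n,a_n)$ converges weakly to $q(\cdot|x,a)$. Assumption B: (i) $w^*<+\infty$; (ii) $\sup_{\alpha\in[0,1)}u_\alpha(x)<+\infty$ for every $x\in\mathbb{X}$. Lower semi-equicontinuity of real functions $\{f_n\}$ on a metric space: for each point $s$ and $\varepsilon>0$ there is $\delta>0$ such that $f_n(s')>f_n(s)-\varepsilon$ for all $s'$ in the open ball $B_\delta(s)$ and all $n$. Asymptotic uniform integrability of $\{f_n\}$ with respect to a measure $\mu$: $\lim_{K\to+\infty}\limsup_{n\to\infty}\int|f_n|\,\mathbf{1}\{|f_n|\ge K\}\,d\mu=0$. *)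

(* Defs.v *)
From HB Require Import structures.
From mathcomp Require Import all_boot all_order all_algebra.
From mathcomp Require Import all_classical all_reals all_analysis.
From mathcomp Require Import measurable_realfun.

Set Implicit Arguments.
Unset Strict Implicit.
Unset Printing Implicit Defensive.

Import Order.TTheory GRing.Theory Num.Theory.
Import numFieldNormedType.Exports.

Local Open Scope classical_set_scope.
Local Open Scope ring_scope.
Local Open Scope ereal_scope.

(* Measurable types of MathComp-Analysis are pointed; for the state and action
   spaces of an MDP with [optimal_average_cost c q < +oo] this is no
   restriction, since an infimum over an empty set is [+oo]. *)
#[short(type="pointedMetricType")]
HB.structure Definition PointedMetric (R : realType) :=
  {T of Metric R T & Pointed T}.

#[short(type="measurableMetricType")]
HB.structure Definition MeasurableMetric (R : realType) (d : measure_display) :=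
  {T of Metric R T & Measurable d T}.

#[short(type="completeMetricType")]
HB.structure Definition CompleteMetric (R : realType) :=
  {T of Metric R T & Complete T}.

Definition separable_space (T : topologicalType) : Prop :=
  exists2 D : set T, countable D & dense D.

(* The metric space [X], with its Borel sigma-algebra, is (via the isometry
   [i]) a Borel subset of the Polish space [S], with the inherited metric. *)
Definition borel_subset_of_polish (R : realType) (d : measure_display)
    (X : measurableMetricType R d) : Prop :=
  (@measurable d X = <<s @open X >>) /\
  exists (S : completeMetricType R) (i : X -> S),
    [/\ separable_space S,
        forall x y : X, mdist (i x) (i y) = mdist x y
      & <<s @open S >> (range i)].

Section trajectories.
Context {d : measure_display} {T : measurableType d}.

Definition trajectory_cylinders : set (set (nat -> T)) :=
  \bigcup_t preimage_set_system setT (fun w : nat -> T => w t) measurable.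

(* T^oo with the product sigma-algebra *)
Definition trajectory := g_sigma_algebraType trajectory_cylinders.

Definition past (t : nat) (w : nat -> T) : t.-tuple T :=
  [tuple w i | i < t].

End trajectories.
Arguments trajectory {d} T.

Section mdp.
Context {R : realType} {dX dA : measure_display}.
Context {X : measurableMetricType R dX} {A : measurableMetricType R dA}.

Definition history (t : nat) (w : nat -> X * A) : t.-tuple (X * A)%type * X :=
  (past t w, (w t).1).

Definition policy : Type :=
  forall t : nat, R.-pker (t.-tuple (X * A)%type * X) ~> A.

Implicit Types (c : X * A -> \bar R) (q : R.-pker (X * A) ~> X).
Implicit Types (pi : policy) (x : X) (alpha : R).

(* [P] makes the initial state [x], the conditional law of the action at time
   [t] given the history [pi t], and the conditional law of the state at time
   [t.+1] given the past [q]. *)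
Definition is_strategic_measure q pi x
    (P : probability (trajectory (X * A)%type) R) : Prop :=
  [/\ forall B : set X, measurable B ->
        P [set w | B (w 0%N).1] = \d_x B,
      forall (t : nat) (H : set (t.-tuple (X * A)%type * X)) (D : set A),
        measurable H -> measurable D ->
        P [set w | H (history t w) /\ D (w t).2] =
        \int[P]_(w in [set w | H (history t w)]) pi t (history t w) D
    & forall (t : nat) (G : set (t.+1.-tuple (X * A)%type)) (B : set X),
        measurable G -> measurable B ->
        P [set w | G (past t.+1 w) /\ B (w t.+1).1] =
        \int[P]_(w in [set w | G (past t.+1 w)]) q (w t) B].

(* The measure given by the Ionescu Tulcea theorem, by which a strategic
   measure exists and is unique on measurable sets; the default value is thus
   never used. *)
Definition strategic_measure q pi x :
    probability (trajectory (X * A)%type) R :=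
  xget (\d_(point : trajectory (X * A)%type)
          : probability (trajectory (X * A)%type) R)
       [set P | is_strategic_measure q pi x P].

Definition finite_horizon_cost c q (N : nat) alpha pi x : \bar R :=
  \int[strategic_measure q pi x]_w
    \sum_(0 <= t < N) (alpha ^+ t)%:E * c (w t).

Definition discounted_cost c q alpha pi x : \bar R :=
  \int[strategic_measure q pi x]_w
    \sum_(0 <= t <oo) (alpha ^+ t)%:E * c (w t).

Definition discounted_value c q alpha x : \bar R :=
  ereal_inf (range (fun pi => discounted_cost c q alpha pi x)).

Definition average_cost c q pi x : \bar R :=
  limn_esup (fun N : nat =>
    (N%:R^-1)%:E * finite_horizon_cost c q N 1%R pi x).

Definition average_value c q x : \bar R :=
  ereal_inf (range (fun pi => average_cost c q pi x)).

Definition optimal_average_cost c q : \bar R :=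
  ereal_inf (range (average_value c q)).

Definition min_discounted_value c q alpha : \bar R :=
  ereal_inf (range (discounted_value c q alpha)).

Definition relative_value c q alpha x : \bar R :=
  discounted_value c q alpha x - min_discounted_value c q alpha.

Definition K_inf_compact c : Prop :=
  forall K : set X, K !=set0 -> compact K ->
  forall l : R, compact [set xa : X * A | K xa.1 /\ c xa <= l%:E].

End mdp.
Arguments policy {R dX dA} X A.

Definition weak_convergence (R : realType) (d : measure_display)
    (X : measurableMetricType R d) (mu_ : nat -> {measure set X -> \bar R})
    (mu : {measure set X -> \bar R}) : Prop :=
  forall f : X -> R, continuous f -> (exists M : R, forall x, (`|f x| <= M)%R) ->
    (fun n => \int[mu_ n]_x (f x)%:E) @ \oo --> \int[mu]_x (f x)%:E.

Definition weakly_continuous (R : realType) (dX dA : measure_display)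
    (X : measurableMetricType R dX) (A : measurableMetricType R dA)
    (q : R.-pker (X * A) ~> X) : Prop :=
  forall (s : nat -> X * A) (p : X * A), s @ \oo --> p ->
    weak_convergence (fun n => q (s n)) (q p).

Definition lower_semi_equicontinuous (R : realType) (X : metricType R)
    (f_ : nat -> X -> \bar R) : Prop :=
  forall (s : X) (e : R), (0 < e)%R ->
  exists2 delta : R, (0 < delta)%R &
    forall s' : X, ball s delta s' -> forall n, f_ n s - e%:E < f_ n s'.

Definition asymptotically_uniformly_integrable (R : realType)
    (d : measure_display) (X : measurableType d)
    (mu : {measure set X -> \bar R}) (f_ : nat -> X -> \bar R) : Prop :=
  (fun K : R => limn_esup (fun n => \int[mu]_x
     (`|f_ n x| * (\1_[set y | (K%:E <= `|f_ n y|)%E] x)%:E)))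
  @ +oo%R --> 0.

(* Main.v *)
(** The discounted values [v_alpha] are the increasing limits of value iteration
    from [0] (costs are first shifted to be nonnegative), hence lower
    semicontinuous solutions of the discounted optimality equation.  Subtracting
    the minima [m_alpha] gives, with [rho_n = (1 - alpha_n) m_(alpha_n)],
      [rho_n + u_n x = min_a (c (x, a) + alpha_n \int u_n dq(x, a))].
    The sequence [rho_n] is bounded; along a subsequence with [rho_n --> r],
    uniform integrability bounds [r + u x] by [c (x, a) + \int u dq(x, a)] for
    every [a], while Fatou's lemma for weakly converging measures, applied to the
    lower semicontinuous minorants [inf_(n >= j) u_n] and to the minimizers of the
    discounted equations, gives an action where the reverse inequality holds.
    A measurable selector [phi] of minimizers has average cost at most [r], and
    the Abelian inequality between average and discounted costs shows that no
    policy does better than [r]; hence [r = w^*]. *)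

Require Import Defs.
From HB Require Import structures.
From mathcomp Require Import all_boot all_order all_algebra.
From mathcomp Require Import all_classical all_reals all_analysis.
From mathcomp Require Import measurable_realfun.
From mathcomp Require Import ring lra.

Set Implicit Arguments.
Unset Strict Implicit.
Unset Printing Implicit Defensive.

Import Order.TTheory GRing.Theory Num.Theory.
Import numFieldNormedType.Exports.

Local Open Scope classical_set_scope.
Local Open Scope ring_scope.
Local Open Scope ereal_scope.

(** * Ionescu Tulcea theorem *)

(** [strategic_measure] is picked by [xget], so nothing is known about it until a measure with its
    three properties has been built; hence the construction of trajectory measures that comes first.
    Costs may be infinite and expectations may diverge. With nonnegative costs every sum and
    integral lives in [[0, +oo]], and only finite quantities are ever subtracted. One compactness
    argument, [inf_compact_limit], serves four times: existence of minimizers, lower semicontinuity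
    of the minimum, the limit of value iteration and the vanishing discount limit. The two halves of
    the limit equation are asymmetric. For a given action the measure is fixed and only [u_n]
    varies, so pointwise convergence and uniform integrability suffice. Along minimizers the measure
    varies too, and pointwise convergence says nothing about the integrals; equicontinuity makes the
    monotone minorants lower semicontinuous, the class of functions for which weak convergence gives
    a one-sided limit. A subsequence is taken for [rho_n] only, since [u_n] converges by
    hypothesis. *)

Section kernel_pullback.
Context d1 d2 d3 (X : measurableType d1) (Y : measurableType d2)
  (Z : measurableType d3) (R : realType).

(** The measurability proof is an argument so that the kernel instances can be inferred from the
    term. *)
Definition kpull (k : R.-pker Y ~> Z) (f : X -> Y) (mf : measurable_fun setT f)
  (x : X) : {measure set Z -> \bar R} := k (f x).

Variables (k : R.-pker Y ~> Z) (f : X -> Y) (mf : measurable_fun setT f).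

Let measurable_kpull U : measurable U ->
  measurable_fun setT (kpull k mf ^~ U).
Proof.
move=> mU; exact: measurableT_comp (measurable_kernel k U mU) mf.
Qed.

HB.instance Definition _ :=
  isKernel.Build _ _ _ _ _ (kpull k mf) measurable_kpull.

Let kpull_prob x : kpull k mf x setT = 1.
Proof. exact: prob_kernel. Qed.

HB.instance Definition _ :=
  Kernel_isProbability.Build _ _ _ _ _ (kpull k mf) kpull_prob.

End kernel_pullback.

Section kernel_bind.
Context d1 d2 d3 (X : measurableType d1) (Y : measurableType d2)
  (Z : measurableType d3) (R : realType).

Definition kbind (l : R.-pker X ~> Y) (k : R.-pker (X * Y) ~> Z)
  (x : X) : {measure set Z -> \bar R} := (l \; k) x.

Variables (l : R.-pker X ~> Y) (k : R.-pker (X * Y) ~> Z).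

Import KCOMP_FINITE_KERNEL.

Let measurable_kbind U : measurable U ->
  measurable_fun setT (kbind l k ^~ U).
Proof. exact: measurable_fun_kcomp_finite. Qed.

HB.instance Definition _ :=
  isKernel.Build _ _ _ _ _ (kbind l k) measurable_kbind.

Let kbind_prob x : kbind l k x setT = 1.
Proof.
rewrite /kbind /= /kcomp.
under eq_integral do rewrite prob_kernel.
by rewrite integral_cst// prob_kernel mule1.
Qed.

HB.instance Definition _ :=
  Kernel_isProbability.Build _ _ _ _ _ (kbind l k) kbind_prob.

Lemma kbindE x U : kbind l k x U = \int[l x]_y k (x, y) U.
Proof. by []. Qed.

Lemma integral_kbind x f : (forall z, 0 <= f z) -> measurable_fun setT f ->
  \int[kbind l k x]_z f z = \int[l x]_y \int[k (x, y)]_z f z.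
Proof. exact: integral_kcomp. Qed.

End kernel_bind.

Definition agree_below (T : Type) (n : nat) (w w' : nat -> T) :=
  forall i, (i < n)%N -> w i = w' i.

(** Phrased as dependence on the first [n] coordinates rather than as a preimage from a finite
    product, so that cylinders of different levels combine without transport between products. *)
Definition cylinder d (T : measurableType d) (n : nat) : set (set (trajectory T)) :=
  [set B : set (trajectory T) |
    measurable B /\ forall w w' : trajectory T, agree_below n w w' -> B w -> B w'].

Section coordinates.
Context d (T : measurableType d).
Local Notation Om := (trajectory T).

Lemma measurable_coordinate n : measurable_fun setT (fun w : Om => w n).
Proof.
move=> _ B mB; rewrite setTI; apply: sub_sigma_algebra; exists n => //.
by exists B => //; rewrite setTI.
Qed.

Lemma measurable_to_trajectory d' (S : measurableType d') (f : S -> Om) :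
  (forall n, measurable_fun setT (fun s => f s n)) -> measurable_fun setT f.
Proof.
move=> mf; apply: (@measurability _ _ S Om setT f trajectory_cylinders) => //.
move=> _ [_ [n _ [B mB <-]] <-]; rewrite !setTI.
by have := mf n measurableT B mB; rewrite setTI.
Qed.

Definition resample_at (n : nat) (wy : Om * T) : Om :=
  fun i => if i == n then wy.2 else wy.1 i.

Lemma measurable_resample_at n : measurable_fun setT (resample_at n).
Proof.
apply: measurable_to_trajectory => i; rewrite /resample_at.
case: eqP => _; first exact: measurable_snd.
exact: measurableT_comp (measurable_coordinate i) measurable_fst.
Qed.

Definition truncate (o : Om) (n : nat) (w : Om) : Om :=
  fun i => if (i < n)%N then w i else o i.

Lemma measurable_truncate o n : measurable_fun setT (truncate o n).
Proof.
apply: measurable_to_trajectory => i; rewrite /truncate.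
by case: ltnP => _; [exact: measurable_coordinate|exact: measurable_cst].
Qed.

Lemma measurable_past n : measurable_fun setT (fun w : Om => past n w).
Proof.
apply/measurable_fun_tnthP => i.
rewrite (_ : _ \o _ = (fun w : Om => w i)); first exact: measurable_coordinate.
by apply/funext => w /=; rewrite tnth_mktuple.
Qed.

Lemma cylinder_coordinate n B : measurable B ->
  cylinder n.+1 [set w : Om | B (w n)].
Proof.
move=> mB; split=> [|w w' ww' /=]; last by rewrite ww'.
by have := measurable_coordinate n measurableT mB; rewrite setTI.
Qed.

Lemma cylinderW m n (B : set Om) : (m <= n)%N -> cylinder m B -> cylinder n B.
Proof.
by move=> mn [mB dB]; split=> // w w' ww'; apply: dB => i im; apply/ww'/(leq_trans im).
Qed.

Lemma cylinderC n (B : set Om) : cylinder n B -> cylinder n (~` B).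
Proof.
move=> [mB dB]; split; first exact: measurableC.
by move=> w w' ww' nBw Bw'; apply: nBw; apply: dB Bw' => i /ww'.
Qed.

Lemma cylinderU n (B C : set Om) : cylinder n B -> cylinder n C ->
  cylinder n (B `|` C).
Proof.
move=> [mB dB] [mC dC]; split; first exact: measurableU.
by move=> w w' ww' [Bw|Cw]; [left; exact: dB Bw|right; exact: dC Cw].
Qed.

Lemma cylinder0 n : cylinder n (set0 : set Om).
Proof. by split. Qed.

Lemma cylinderE n (B : set Om) w w' : cylinder n B -> agree_below n w w' ->
  B w = B w'.
Proof.
move=> [_ dB] ww'; apply/propext; split; apply: dB => //.
by move=> i /ww'.
Qed.

End coordinates.

(* Carries the algebra of cylinders, whereas [trajectory T] carries the
   sigma-algebra they generate. *)
Definition cylinder_space d (T : measurableType d) : Type := nat -> T.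

Section cylinder_algebra.
Context d (T : measurableType d).
Local Notation Om := (trajectory T).

HB.instance Definition _ := Pointed.on (cylinder_space T).

Definition cylinders : set (set (cylinder_space T)) :=
  [set B | exists n, cylinder n (B : set Om)].

Lemma cylinders0 : cylinders set0.
Proof. by exists 0%N; exact: cylinder0. Qed.

Lemma cylindersU : setU_closed cylinders.
Proof.
move=> B C [n cB] [m cC]; exists (maxn n m).
apply: cylinderU; first exact: cylinderW (leq_maxl _ _) cB.
exact: cylinderW (leq_maxr _ _) cC.
Qed.

Lemma cylindersC : setC_closed cylinders.
Proof. by move=> B [n cB]; exists n; exact: cylinderC. Qed.

HB.instance Definition _ := @isAlgebraOfSets.Build default_measure_display
  (cylinder_space T) cylinders cylinders0 cylindersU cylindersC.

End cylinder_algebra.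

Lemma integral_diracr d (T : measurableType d) (R : realType)
    (mu : {measure set T -> \bar R}) (B : set T) :
  measurable B -> \int[mu]_z \d_z B = mu B.
Proof.
move=> mB; rewrite -[in RHS](setIT B) -integral_indic//.
Qed.

Definition nonanticipating d (T : measurableType d) (R : realType)
    (kappa : nat -> R.-pker trajectory T ~> T) :=
  forall n w w' U, agree_below n w w' -> kappa n w U = kappa n w' U.

Section ionescu_tulcea.
Context d (T : measurableType d) (R : realType).
Local Notation Om := (trajectory T).
Variable kappa : nat -> R.-pker Om ~> T.
Hypothesis kappa_past : nonanticipating kappa.
Variable o : Om.

(** All kernels go from full trajectories to full trajectories: a partial history is a trajectory
    whose later coordinates are placeholders, overwritten one after the other. *)
Definition resample n : R.-pker Om ~> Om :=
  kbind (kappa n) (kdirac (measurable_resample_at (T := T) n)).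

Lemma integral_resample n w f : (forall z, 0 <= f z) -> measurable_fun setT f ->
  \int[resample n w]_z f z = \int[kappa n w]_y f (resample_at n (w, y)).
Proof.
move=> f0 mf; rewrite /resample integral_kbind//; apply: eq_integral => y _.
by rewrite integral_dirac// diracT mul1e.
Qed.

Lemma agree_resample_at n (w : Om) (y : T) : agree_below n (resample_at n (w, y)) w.
Proof. by move=> i; rewrite /resample_at; case: eqP => // ->; rewrite ltnn. Qed.

Lemma resample_cylinder n w (B : set Om) : cylinder n B ->
  resample n w B = \d_w B.
Proof.
move=> cB; rewrite kbindE (eq_integral (cst (\d_w B))) => [|y _ /=].
  by rewrite integral_cst// prob_kernel mule1.
rewrite /kdirac/= !diracE; congr (_%:R%:E); congr nat_of_bool.
by apply/idP/idP; rewrite !inE (cylinderE cB (agree_resample_at w y)).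
Qed.

(* [multistep m j w] is the law of the trajectory after resampling the
   coordinates [m, .., m + j - 1] of [w]. *)
Fixpoint multistep (m j : nat) : R.-pker Om ~> Om :=
  if j is j'.+1 then
    kbind (resample m)
      (kpull (multistep m.+1 j')
        (measurable_snd : measurable_fun setT (snd : Om * Om -> Om)))
  else kdirac (@measurable_id _ Om setT).

Lemma multistep0 m w U : multistep m 0 w U = \d_w U.
Proof. by []. Qed.

Lemma multistepS m j w U :
  multistep m j.+1 w U = \int[resample m w]_z multistep m.+1 j z U.
Proof. by []. Qed.

Lemma integral_multistepS m j w f :
  (forall z, 0 <= f z) -> measurable_fun setT f ->
  \int[multistep m j.+1 w]_z f z =
  \int[resample m w]_z \int[multistep m.+1 j z]_t f t.
Proof. by move=> f0 mf; exact: integral_kbind. Qed.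

(** The recursion peels off the first resampling, whereas a comparison of two horizons has to peel
    off the last one. *)
Lemma multistep_last m j w U : measurable U ->
  multistep m j.+1 w U = \int[multistep m j w]_z resample (m + j) z U.
Proof.
move=> mU; elim: j m w => [m w|j IHj m w].
  rewrite multistepS integral_diracr// addn0 integral_dirac//.
    by rewrite diracT mul1e.
  exact: measurable_kernel.
rewrite multistepS integral_multistepS//; last exact: measurable_kernel.
by apply: eq_integral => z _; rewrite IHj addnS.
Qed.

Lemma multistep_cylinder n m j w (B : set Om) : (n <= m)%N -> cylinder n B ->
  multistep m j w B = \d_w B.
Proof.
move=> + cB; elim: j m w => [//|j IHj] m w nm.
rewrite multistepS; under eq_integral do rewrite IHj 1?ltnW//.
rewrite integral_diracr; last exact: cB.1.
by rewrite resample_cylinder//; exact: cylinderW cB.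
Qed.

(** Consistency of the finite-dimensional laws: resampling coordinates from [n] on does not affect a
    cylinder of level [n]. It makes [cylinder_content] independent of the chosen level. *)
Lemma multistep_stable n m j i w (B : set Om) : (n <= m + j)%N ->
  cylinder n B -> multistep m (j + i) w B = multistep m j w B.
Proof.
move=> nmj cB; elim: i => [|i IHi]; first by rewrite addn0.
rewrite addnS multistep_last; last exact: cB.1.
under eq_integral => z _.
  rewrite resample_cylinder; last first.
    by apply: cylinderW cB; rewrite addnA (leq_trans nmj)// leq_addr.
  over.
by rewrite integral_diracr//; exact: cB.1.
Qed.

Section continuity.
Variables (B : nat -> set Om) (n : nat -> nat).
Hypothesis cB : forall k, cylinder (n k) (B k).
Hypothesis B_nonincreasing : forall k k', (k <= k')%N -> B k' `<=` B k.

(** The conditional probability of [B k] once the first [m] coordinates are those of [w]. When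
    [n k <= m] the truncated subtraction is 0 and [Q m k w] is 0 or 1: the event is decided. *)
Let Q m k w := multistep m (n k - m) w (B k).

Let Q_step m k w : Q m k w = \int[kappa m w]_y Q m.+1 k (resample_at m (w, y)).
Proof.
rewrite /Q -(@integral_resample m w (fun z => multistep m.+1 (n k - m.+1) z (B k)))//;
  last exact: (measurable_kernel _ _ (cB k).1).
have [nkm|mnk] := leqP (n k) m; last by rewrite -subnSK.
under eq_integral do rewrite (multistep_cylinder _ _ (leqW nkm) (cB k)).
rewrite (multistep_cylinder _ _ nkm (cB k)).
rewrite integral_diracr; last exact: (cB k).1.
by rewrite resample_cylinder//; exact: cylinderW (cB k).
Qed.

Let Q_le m k k' w : (k <= k')%N -> Q m k' w <= Q m k w.
Proof.
move=> kk'; rewrite /Q.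
(* Both laws are extended to the common horizon [(n k - m) + n k'], so that a single measure
   compares the two sets. *)
rewrite -(@multistep_stable (n k) m (n k - m) (n k') w (B k))//; last first.
  by rewrite -maxnE leq_maxr.
rewrite -(@multistep_stable (n k') m (n k' - m) ((n k - m) + n k' - (n k' - m)) w
  (B k'))//; last by rewrite -maxnE leq_maxr.
rewrite subnKC; last by rewrite (leq_trans (leq_subr _ _))// leq_addl.
apply: le_measure; rewrite ?inE; [exact: (cB k').1|exact: (cB k).1|].
exact: B_nonincreasing.
Qed.

Let positive m w := exists2 e : R, (0 < e)%R & forall k, e%:E <= Q m k w.

(** Otherwise, for every [y], the conditional probabilities, which decrease in [k], would tend to 0;
    by dominated convergence so would their average [Q m k w]. The lower bound may shrink at each
    step; only its positivity is passed on. *)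
Let positive_step m w : positive m w ->
  exists y, positive m.+1 (resample_at m (w, y)).
Proof.
move=> [e e0 eQ]; apply: contrapT => /forallNP nex.
pose f k y := Q m.+1 k (resample_at m (w, y)).
have mf k : measurable_fun setT (f k).
  apply: (measurableT_comp (measurable_kernel _ _ (cB k).1)).
  exact: measurableT_comp (measurable_resample_at (T := T) m) (pair1_measurable w).
have f0 k y : 0 <= f k y by exact: measure_ge0.
have f1 k y : f k y <= 1.
  by rewrite -(@prob_kernel _ _ _ _ _ (multistep m.+1 (n k - m.+1))
    (resample_at m (w, y))) le_measure ?inE//; exact: (cB k).1.
have f1' k y : `|f k y| <= 1 by rewrite gee0_abs.
have f_cvg y : f ^~ y @ \oo --> (0 : \bar R).
  rewrite (_ : 0 = ereal_inf (range (f ^~ y))); last first.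
    apply/eqP; rewrite eq_le; apply/andP; split.
      by apply: le_ereal_inf_tmp => _ [k _ <-].
    apply/lee_addgt0Pr => r r0; rewrite add0e.
    have /existsNP[k /negP] : ~ forall k, r%:E <= f k y.
      by move=> rf; apply: (nex y); exists r.
    rewrite -ltNge => /ltW; apply: le_trans.
    by apply: ereal_inf_lbound; exists k.
  by apply: ereal_nonincreasing_cvgn => k k' kk'; exact: Q_le.
have i1 : (kappa m w).-integrable setT (cst 1 : T -> \bar R).
  apply/integrableP; split; first exact: measurable_cst.
  under eq_integral do rewrite /= normr1.
  by rewrite integral_cst// prob_kernel mule1 ltry.
have [_ _ cvg0] := @dominated_convergence _ _ _ (kappa m w) setT measurableT f
  (cst 0) (cst 1) mf (measurable_cst _) (aeW _ (fun y _ => f_cvg y)) i1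
  (aeW _ (fun y k _ => f1' k y)).
have : e%:E <= 0.
  rewrite -(integral0 (kappa m w) setT).
  by apply: cvge_ge cvg0; apply: nearW => k; rewrite (le_trans (eQ k))// Q_step.
by rewrite lee_fin leNgt e0.
Qed.

Let next m w := xget point [set y | positive m.+1 (resample_at m (w, y))].

Fixpoint good_path (m : nat) : Om :=
  if m is m'.+1 then resample_at m' (good_path m', next m' (good_path m')) else o.

Lemma cylinder_continuity (e : R) : (0 < e)%R ->
  (forall k, e%:E <= multistep 0 (n k) o (B k)) -> \bigcap_k B k !=set0.
Proof.
move=> e0 eB.
have pos m : positive m (good_path m).
  elim: m => [|m /positive_step[y py]].
    by exists e => // k; rewrite /Q subn0; exact: eB.
  rewrite /=; have := xgetI point (py : [set y | _] y).
  by rewrite /next; apply.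
(* Coordinate [i] is chosen at stage [i.+1] and never changed afterwards. *)
pose w : Om := fun i => good_path i.+1 i.
have good_pathE m : agree_below m (good_path m) w.
  elim: m => [//|m IHm] i; rewrite ltnS leq_eqVlt => /predU1P[->//|im].
  by rewrite -IHm//= /resample_at (ltn_eqF im).
exists w => k _; apply: (cB k).2 (good_pathE (n k)) _.
(* At stage [n k] the event [B k] is decided, so a positive conditional probability means that it
   holds. *)
have [r r0 /(_ k)] := pos (n k).
rewrite /Q subnn multistep0 diracE; have [/set_mem//|_] := boolP (_ \in _).
by rewrite lee_fin leNgt r0.
Qed.

End continuity.
Definition cylinder_level (B : set (cylinder_space T)) : nat :=
  xget 0%N [set n | cylinder n (B : set Om)].

Definition cylinder_content (B : set (cylinder_space T)) : \bar R :=
  multistep 0 (cylinder_level B) o B.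

Lemma cylinder_contentE n (B : set Om) : cylinder n B ->
  cylinder_content B = multistep 0 n o B.
Proof.
move=> cB; rewrite /cylinder_content; set l := cylinder_level _.
have cl : cylinder l B by exact: (@xgetI _ 0%N [set n | cylinder n (B : set Om)] n cB).
rewrite -(@multistep_stable l 0 l n o B)//.
by rewrite -(@multistep_stable n 0 n l o B)// addnC.
Qed.

Let content0 : cylinder_content set0 = 0.
Proof. by rewrite (cylinder_contentE (cylinder0 T 0)) measure0. Qed.

Let content_ge0 B : 0 <= cylinder_content B.
Proof. exact: measure_ge0. Qed.

Let content_fin B : measurable B -> cylinder_content B \is a fin_num.
Proof.
move=> [n cB]; rewrite (cylinder_contentE cB) ge0_fin_numE//.
rewrite (le_lt_trans _ (ltry 1%R))//.
rewrite -(@prob_kernel _ _ _ _ _ (multistep 0 n) o) le_measure ?inE//.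
exact: cB.1.
Qed.

Let contentU (B C : set (cylinder_space T)) : measurable B -> measurable C ->
  B `&` C = set0 ->
  cylinder_content (B `|` C) = cylinder_content B + cylinder_content C.
Proof.
move=> [n cB] [m cC] BC0.
have cB' := cylinderW (leq_maxl n m) cB.
have cC' := cylinderW (leq_maxr n m) cC.
rewrite (cylinder_contentE (cylinderU cB' cC')) (cylinder_contentE cB').
rewrite (cylinder_contentE cC') measureU//; [exact: cB.1|exact: cC.1].
Qed.

(** Finite additivity reduces the claim to showing that the remainders have content tending to 0.
    They decrease to the empty set, so a positive limit would contradict [cylinder_continuity]. *)
Let content_sigma_additive : semi_sigma_additive cylinder_content.
Proof.
move=> F mF tF mU; set U := \bigcup_n F n.
(* The tail of the disjoint union, described as what the first [n] sets leave of [U]: in this form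
   each tail is again a cylinder, by induction. *)
pose B n := U `&` [set w | forall i, (i < n)%N -> ~ F i w].
have BS n : B n.+1 = B n `\` F n.
  apply/seteqP; split=> w.
    move=> [Uw nF]; split; last exact: nF.
    by split=> // i iln; apply: nF; exact: ltnW.
  move=> [[Uw nF] nFn]; split=> // i; rewrite ltnS leq_eqVlt.
  by move=> /predU1P[->//|]; exact: nF.
have mB n : measurable (B n).
  elim: n => [|n IHn]; last by rewrite BS; exact: measurableD.
  by rewrite (_ : B 0%N = U)//; apply/seteqP; split=> [w []//|w Uw]; split.
have BF n : B n = F n `|` B n.+1.
  rewrite BS setUDr setDv setD0; apply/esym/setUidr => w Fw.
  split; first by exists n.
  move=> i iltn Fiw; have := tF i n I I (ex_intro _ w (conj Fiw Fw)).
  by move=> /eqP; rewrite (ltn_eqF iltn).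
have cBS n : cylinder_content (B n) =
    cylinder_content (F n) + cylinder_content (B n.+1).
  rewrite {1}BF contentU// BS; apply/seteqP; split=> // w [Fw [_]]; exact.
have UE n : cylinder_content U =
    \sum_(0 <= i < n) cylinder_content (F i) + cylinder_content (B n).
  elim: n => [|n IHn].
    rewrite big_geq// add0e; congr cylinder_content.
    by apply/seteqP; split=> [w Uw|w []//]; split.
  by rewrite IHn big_nat_recr//= -addeA -cBS.
have B_le n m : (n <= m)%N -> B m `<=` B n.
  by move=> nm w [Uw nF]; split=> // i iln; apply: nF; exact: leq_trans nm.
have cB_le n m : (n <= m)%N -> cylinder_content (B m) <= cylinder_content (B n).
  move=> nm; rewrite -(setUidr (B_le _ _ nm)) (_ : _ `|` _ = B m `|` (B n `\` B m)).
    rewrite contentU ?leeDl//; first exact: measurableD.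
    by rewrite setDE setICA setICr setI0.
  by rewrite setUDr setDv setD0.
have cvgB : (cylinder_content \o B) @ \oo --> 0.
  have cvg_inf := ereal_nonincreasing_cvgn (fun n m => @cB_le n m).
  rewrite (_ : 0 = ereal_inf (range (cylinder_content \o B)))//.
  apply/eqP; rewrite eq_le; apply/andP; split.
    by apply: le_ereal_inf_tmp => _ [k _ <-].
  rewrite leNgt; apply/negP => inf0.
  have [e e0 einf] : exists2 e : R, (0 < e)%R &
      e%:E <= ereal_inf (range (cylinder_content \o B)).
    case: ereal_inf inf0 => [r||//] r0; first by exists r.
    by exists 1%R => //; rewrite leey.
  have [n cB] := choice mB.
  have [k|w Bw] := @cylinder_continuity B n cB B_le e e0.
    rewrite -(cylinder_contentE (cB k)) (le_trans einf)//.
    by apply: ereal_inf_lbound; exists k.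
  have [[i _ Fiw] _] := Bw 0%N I.
  by have [_ /(_ i (ltnSn i))] := Bw i.+1 I.
rewrite (_ : (fun n => _) = (fun n => cylinder_content U - cylinder_content (B n))).
  rewrite -[X in _ --> X]sube0; apply: cvgeB; [|exact: cvg_cst|exact: cvgB].
  by rewrite fin_num_adde_defr// content_fin.
by apply/funext => n; rewrite (UE n) addeK// content_fin.
Qed.

HB.instance Definition _ := isMeasure.Build _ (cylinder_space T) R
  cylinder_content content0 content_ge0 content_sigma_additive.

(** Coordinate preimages are cylinders, so the extension from the algebra of cylinders is defined on
    the whole sigma-algebra of [trajectory T]. *)
Let measurable_cylinder_id : measurable_fun setT
  (id : g_sigma_algebraType (@measurable _ (cylinder_space T)) -> Om).
Proof.
apply: measurable_to_trajectory => n _ B mB; rewrite setTI.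
by apply: sub_sigma_algebra; exists n.+1; exact: cylinder_coordinate.
Qed.

Definition ionescu_tulcea_measure (_ : nonanticipating kappa) (B : set Om) : \bar R :=
  measure_extension cylinder_content B.

Local Notation itm := (ionescu_tulcea_measure kappa_past).

Let measurable_extension (B : set Om) : measurable B ->
  @measurable _ (g_sigma_algebraType (@measurable _ (cylinder_space T))) B.
Proof. by move=> mB; have := measurable_cylinder_id measurableT mB; rewrite setTI. Qed.

Let itm0 : itm set0 = 0.
Proof. exact: (measure0 (measure_extension cylinder_content)). Qed.

Let itm_ge0 B : 0 <= itm B.
Proof. exact: (measure_ge0 (measure_extension cylinder_content)). Qed.

Let itm_sigma_additive : semi_sigma_additive itm.
Proof.
move=> F mF tF mU.
apply: (@measure_semi_sigma_additive _ _ _ (measure_extension cylinder_content)) => //.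
  by move=> n; exact: measurable_extension.
exact: measurable_extension.
Qed.

HB.instance Definition _ := isMeasure.Build _ Om R itm
  itm0 itm_ge0 itm_sigma_additive.

Lemma ionescu_tulcea_cylinder n (B : set Om) : cylinder n B ->
  itm B = multistep 0 n o B.
Proof.
move=> cB; rewrite -(cylinder_contentE cB).
by apply: (@measurable_mu_extE _ _ _ cylinder_content); exists n.
Qed.

Let itm_setT : itm setT = 1.
Proof.
rewrite (@ionescu_tulcea_cylinder 0); first exact: prob_kernel.
by rewrite -setC0; exact/cylinderC/cylinder0.
Qed.

HB.instance Definition _ := Measure_isProbability.Build _ Om R
  itm itm_setT.

(** Preimages under [truncate o n] are cylinders of level [n], so the two measures have the same
    image under it, and [f] does not see the truncation. *)
Lemma integral_ionescu_tulcea n (f : Om -> \bar R) : (forall w, 0 <= f w) ->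
  measurable_fun setT f -> (forall w w', agree_below n w w' -> f w = f w') ->
  \int[itm]_w f w = \int[multistep 0 n o]_w f w.
Proof.
move=> f0 mf fn.
have mt := measurable_truncate (T := T) o n.
have fE w : f (truncate o n w) = f w.
  by apply: fn => i iln; rewrite /truncate iln.
have int_truncate (mu : {measure set Om -> \bar R}) :
    \int[mu]_z f z = \int[pushforward mu (truncate o n)]_z f z.
  rewrite [RHS]ge0_integral_pushforward//.
  rewrite preimage_setT.
  by apply: eq_integral => z _; rewrite /= fE.
rewrite (int_truncate itm) (int_truncate (multistep 0 n o)).
apply: eq_measure_integral => C mC _; rewrite /= /pushforward.
rewrite (@ionescu_tulcea_cylinder n)//; split.
  by have := mt measurableT C mC; rewrite setTI.
move=> w w' ww'; rewrite /preimage/=.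
suff -> : truncate o n w = truncate o n w' by [].
by apply/funext => i; rewrite /truncate; case: ltnP => // iln; exact: ww'.
Qed.

(** This says that [kappa n] is the conditional law of coordinate [n]. The horizon [n.+1] is split
    by [multistep_last]; the inner integral depends on the first [n] coordinates only, by
    [kappa_past], and can be integrated against the full measure again. *)
Lemma ionescu_tulcea_step n (f : Om -> \bar R) : (forall w, 0 <= f w) ->
  measurable_fun setT f -> (forall w w', agree_below n.+1 w w' -> f w = f w') ->
  \int[itm]_w f w =
  \int[itm]_w \int[kappa n w]_y f (resample_at n (w, y)).
Proof.
move=> f0 mf fn; rewrite (integral_ionescu_tulcea f0 mf fn).
pose g w := \int[resample n w]_z f z.
have gE w : g w = \int[kappa n w]_y f (resample_at n (w, y)).
  exact: integral_resample.
have mg : measurable_fun setT g.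
  by apply: measurable_fun_integral_kernel => //; exact: measurable_kernel.
transitivity (\int[itm]_w g w); last exact: eq_integral.
rewrite (@integral_ionescu_tulcea n)//; first last.
- move=> w w' ww'; rewrite !gE (eq_measure_integral (kappa n w')) => [|U _ _].
    apply: eq_integral => y _; apply: fn => i; rewrite /resample_at/= ltnS.
    by rewrite leq_eqVlt => /predU1P[->|iln]; rewrite ?eqxx// ww'.
  exact: kappa_past.
- by move=> w; exact: integral_ge0.
rewrite (eq_measure_integral (kbind (multistep 0 n)
    (kpull (resample n) (measurable_snd : measurable_fun setT (snd : Om * Om -> Om)))
    o)) => [|U mU _]; last exact: multistep_last.
by rewrite integral_kbind.
Qed.

End ionescu_tulcea.

(** * Strategic measures *)

Lemma integral_kernel_cst d1 d2 (X : measurableType d1) (Y : measurableType d2)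
    (R : realType) (k : R.-pker X ~> Y) x (r : \bar R) : \int[k x]_y r = r.
Proof.
by transitivity (\int[k x]_y cst r y); rewrite // integral_cst// prob_kernel mule1.
Qed.

Lemma integral_probability_cst d (X : measurableType d) (R : realType)
    (P : probability X R) (r : \bar R) : \int[P]_y r = r.
Proof.
transitivity (\int[P]_y cst r y); first by [].
by rewrite integral_cst// [X in _ * X](probability_setT P) mule1.
Qed.

Section kernel_const.
Context d1 d2 (X : measurableType d1) (Y : measurableType d2) (R : realType).

Definition kconst (P : probability Y R) (x : X) : {measure set Y -> \bar R} := P.

Variable P : probability Y R.

Let measurable_kconst U : measurable U -> measurable_fun setT (kconst P ^~ U).
Proof. by move=> mU; exact: measurable_cst. Qed.

HB.instance Definition _ :=
  isKernel.Build _ _ _ _ _ (kconst P) measurable_kconst.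

Let kconst_prob x : kconst P x setT = 1.
Proof. exact: probability_setT. Qed.

HB.instance Definition _ :=
  Kernel_isProbability.Build _ _ _ _ _ (kconst P) kconst_prob.

End kernel_const.

(** The hypothesis on sets identifies the law of [f] with the mixture of [k] by [P]. Viewing [P] as
    a kernel with source [unit] turns this mixture into a [kbind], for which the integral formula is
    available. *)
Lemma integral_disintegration d1 d2 d3 (Om : measurableType d1)
    (Y : measurableType d2) (Z : measurableType d3) (R : realType)
    (P : probability Om R) (k : R.-pker Y ~> Z) (f : Om -> Z) (h : Om -> Y)
    (g : Z -> \bar R) :
  measurable_fun setT f -> measurable_fun setT h ->
  (forall B, measurable B -> P (f @^-1` B) = \int[P]_w k (h w) B) ->
  measurable_fun setT g -> (forall z, 0 <= g z) ->
  \int[P]_w g (f w) = \int[P]_w \int[k (h w)]_z g z.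
Proof.
move=> mf mh Pk mg g0.
have mh2 : measurable_fun setT (fun x : unit * Om => h x.2).
  exact: measurableT_comp mh measurable_snd.
transitivity (\int[pushforward P f]_z g z).
  by rewrite [RHS]ge0_integral_pushforward// => z _; exact: g0.
rewrite (eq_measure_integral
  (kbind (@kconst _ _ unit _ _ P) (kpull k mh2) tt)) => [|B mB _].
  by rewrite integral_kbind.
by rewrite kbindE /= /pushforward Pk.
Qed.

Section strategic_measure_existence.
Context {R : realType} {dX dA : measure_display}.
Context {X : measurableMetricType R dX} {A : measurableMetricType R dA}.
Variables (q : R.-pker (X * A) ~> X) (pi : @policy R dX dA X A) (x : X).
Local Notation Om := (trajectory (X * A)%type).

Lemma agree_past n (w w' : Om) : agree_below n w w' -> past n w = past n w'.
Proof.
by move=> ww'; apply: eq_from_tnth => i; rewrite !tnth_mktuple ww'.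
Qed.

Let measurable_observation n :
  measurable_fun setT (fun wx : Om * X => (past n wx.1, wx.2)).
Proof.
apply/measurable_fun_pairP; split; last exact: measurable_snd.
exact: measurableT_comp (@measurable_past _ _ n) measurable_fst.
Qed.

Let measurable_forget :
  measurable_fun setT (fun wxa : Om * X * A => (wxa.1.2, wxa.2)).
Proof.
apply/measurable_fun_pairP; split; last exact: measurable_snd.
exact: measurableT_comp measurable_snd measurable_fst.
Qed.

Definition next_state (n : nat) : R.-pker Om ~> X :=
  if n is n'.+1 then kpull q (@measurable_coordinate _ (X * A)%type n')
  else kdirac (measurable_cst x).

(** [kbind] returns only the last draw, so a final Dirac kernel puts the state and the action back
    together. *)
Definition next_stage (n : nat) : R.-pker Om ~> (X * A)%type :=
  kbind (next_state n)
    (kbind (kpull (pi n) (@measurable_observation n)) (kdirac measurable_forget)).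

Lemma integral_next_stage n w (f : X * A -> \bar R) :
  (forall y, 0 <= f y) -> measurable_fun setT f ->
  \int[next_stage n w]_y f y =
  \int[next_state n w]_y \int[pi n (past n w, y)]_a f (y, a).
Proof.
move=> f0 mf; rewrite integral_kbind//; apply: eq_integral => y _.
rewrite integral_kbind//; apply: eq_integral => a _.
by rewrite integral_dirac// diracT mul1e.
Qed.

Lemma next_stage_past : nonanticipating next_stage.
Proof.
move=> n w w' U ww'; rewrite !kbindE.
have -> : next_state n w = next_state n w'.
  by case: n ww' => [//|n] ww'; rewrite /= /kpull ww'.
apply: eq_integral => y _; rewrite !kbindE.
rewrite (eq_measure_integral (kpull (pi n) (@measurable_observation n) (w', y)))//.
by move=> C mC _; rewrite /= /kpull/= (agree_past ww').
Qed.

Let P : probability Om R := ionescu_tulcea_measure point next_stage_past.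

Let strategic_step n (g : n.-tuple (X * A)%type * X * A -> \bar R) :
  (forall z, 0 <= g z) -> measurable_fun setT g ->
  \int[P]_w g (past n w, (w n).1, (w n).2) =
  \int[P]_w \int[next_state n w]_y \int[pi n (past n w, y)]_a g (past n w, y, a).
Proof.
move=> g0 mg.
have mp := @measurable_past _ (X * A)%type n.
have mc := @measurable_coordinate _ (X * A)%type n.
rewrite (@ionescu_tulcea_step _ _ _ _ next_stage_past point n
  (fun w => g (past n w, (w n).1, (w n).2)))//; first last.
- by move=> w w' ww'; rewrite (@agree_past n w w') ?ww'// => i /ltnW; exact: ww'.
- apply: measurableT_comp mg _; apply/measurable_fun_pairP; split.
    apply/measurable_fun_pairP; split; first exact: mp.
    exact: measurableT_comp measurable_fst mc.
  exact: measurableT_comp measurable_snd mc.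
apply: eq_integral => w _.
have resampleE y : past n (resample_at n (w, y)) = past n w.
  exact/agree_past/agree_resample_at.
under eq_integral do rewrite resampleE /resample_at/= eqxx.
rewrite (integral_next_stage _ _ (f := fun y => g (past n w, y.1, y.2)))//.
apply: measurableT_comp mg _; apply/measurable_fun_pairP; split.
  by apply/measurable_fun_pairP; split; [exact: measurable_cst|exact: measurable_fst].
exact: measurable_snd.
Qed.

Lemma strategic_measure_exists :
  exists P : probability Om R, is_strategic_measure q pi x P.
Proof.
have mc1 n : measurable_fun setT (fun w : Om => (w n).1).
  exact: measurableT_comp measurable_fst (@measurable_coordinate _ (X * A)%type n).
have mc2 n : measurable_fun setT (fun w : Om => (w n).2).
  exact: measurableT_comp measurable_snd (@measurable_coordinate _ (X * A)%type n).
have mp n := @measurable_past _ (X * A)%type n.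
have mh n : measurable_fun setT (fun w : Om => history n w).
  by apply/measurable_fun_pairP; split; [exact: mp|exact: mc1].
have mpre d' (S : measurableType d') (f : Om -> S) (B : set S) :
    measurable_fun setT f -> measurable B -> measurable (f @^-1` B).
  by move=> mf mB; have := mf measurableT B mB; rewrite setTI.
(* Probabilities and restricted integrals are rewritten as integrals of Dirac masses over the whole
   space; each of the three properties then follows from [strategic_step]. *)
have PE (B : set Om) : measurable B -> P B = \int[P]_w \d_w B.
  by move=> mB; rewrite integral_diracr.
have mdirac d' (S : measurableType d') (B : set S) : measurable B ->
    measurable_fun setT (fun z => \d_z B : \bar R).
  move=> mB; exact/measurable_EFinP/measurable_indic.
have diracI d1 d2 (S1 : measurableType d1) (S2 : measurableType d2)
    (f1 : Om -> S1) (f2 : Om -> S2) B1 B2 (w : Om) :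
    \d_w [set w | B1 (f1 w) /\ B2 (f2 w)] = \d_(f1 w) B1 * \d_(f2 w) B2 :> \bar R.
  rewrite !diracE -EFinM -natrM mulnb; congr (_%:R%:E); congr nat_of_bool.
  apply/idP/andP => [/set_mem[b1 b2]|[/set_mem b1 /set_mem b2]].
    by split; exact: mem_set.
  by apply: mem_set; split.
have restrictE (B : set Om) (f : Om -> \bar R) :
    \int[P]_(w in B) f w = \int[P]_w (\d_w B * f w).
  rewrite integral_mkcond; apply: eq_integral => w _.
  by rewrite epatch_indic muleC.
exists P; split.
- move=> B mB; rewrite PE; last exact: mpre.
  rewrite (@strategic_step 0 (fun z => \d_z.1.2 B))//; last first.
    apply: measurableT_comp (mdirac _ _ _ mB) _.
    exact: measurableT_comp measurable_snd measurable_fst.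
  rewrite (eq_integral (cst (\d_x B))) => [|w _].
    exact: integral_probability_cst.
  under eq_integral do rewrite /= integral_kernel_cst.
  by rewrite integral_diracr.
- move=> t H D mH mD; rewrite PE; last first.
    apply: measurableI; first exact: (mpre _ _ _ _ (mh t) mH).
    exact: (mpre _ _ _ _ (mc2 t) mD).
  rewrite [RHS]restrictE.
  have mH1 : measurable_fun setT
      (fun z : t.-tuple (X * A)%type * X * A => \d_z.1 H : \bar R).
    exact: measurableT_comp (mdirac _ _ _ mH) measurable_fst.
  rewrite (eq_integral (fun w : Om => \d_(history t w) H * \d_(w t).2 D)) => [|w _];
    last exact: (diracI _ _ _ _ (history t) (fun w => (w t).2)).
  rewrite (@strategic_step t (fun z => \d_z.1 H * \d_z.2 D)); first last.
  + apply: emeasurable_funM => //.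
    exact: measurableT_comp (mdirac _ _ _ mD) measurable_snd.
  + by move=> z; rewrite mule_ge0.
  rewrite [RHS](@strategic_step t (fun z => \d_z.1 H * pi t z.1 D)); first last.
  + apply: emeasurable_funM => //.
    exact: measurableT_comp (measurable_kernel _ _ mD) measurable_fst.
  + by move=> z; rewrite mule_ge0.
  apply: eq_integral => w _; apply: eq_integral => y _.
  rewrite /= ge0_integralZl//=; last exact: mdirac.
  by rewrite integral_diracr// integral_kernel_cst.
- move=> t G B mG mB; rewrite PE; last first.
    apply: measurableI; first exact: (mpre _ _ _ _ (mp t.+1) mG).
    exact: (mpre _ _ _ _ (mc1 t.+1) mB).
  rewrite [RHS]restrictE.
  rewrite (eq_integral (fun w : Om => \d_(past t.+1 w) G * \d_(w t.+1).1 B)) => [|w _];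
    last exact: (diracI _ _ _ _ (past t.+1) (fun w => (w t.+1).1)).
  rewrite (@strategic_step t.+1 (fun z => \d_z.1.1 G * \d_z.1.2 B)); first last.
  + apply: emeasurable_funM.
      apply: measurableT_comp (mdirac _ _ _ mG) _.
      exact: measurableT_comp measurable_fst measurable_fst.
    apply: measurableT_comp (mdirac _ _ _ mB) _.
    exact: measurableT_comp measurable_snd measurable_fst.
  + by move=> z; rewrite mule_ge0.
  apply: eq_integral => w _.
  under eq_integral do rewrite /= integral_kernel_cst.
  rewrite /= ge0_integralZl//=; last exact: mdirac.
  by rewrite integral_diracr.
Qed.

Lemma strategic_measureP : is_strategic_measure q pi x (strategic_measure q pi x).
Proof. by have [P' /xgetI] := strategic_measure_exists; apply. Qed.

End strategic_measure_existence.

Section strategic_measure_theory.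
Context {R : realType} {dX dA : measure_display}.
Context {X : measurableMetricType R dX} {A : measurableMetricType R dA}.
Variables (q : R.-pker (X * A) ~> X) (pi : @policy R dX dA X A) (x : X).
Local Notation Om := (trajectory (X * A)%type).
Local Notation P := (strategic_measure q pi x).

Lemma measurable_state n : measurable_fun setT (fun w : Om => (w n).1).
Proof.
exact: measurableT_comp measurable_fst (@measurable_coordinate _ (X * A)%type n).
Qed.

Lemma integral_initial_state (g : X -> \bar R) :
  measurable_fun setT g -> (forall z, 0 <= g z) -> \int[P]_w g (w 0%N).1 = g x.
Proof.
move=> mg g0; have [P1 _ _] := strategic_measureP q pi x.
rewrite (@integral_disintegration _ _ _ _ _ _ _ P (kdirac (measurable_cst x))
  (fun w => (w 0%N).1) (fun w => (w 0%N).1))//; first last.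
- move=> B mB; rewrite [LHS]P1// (eq_integral (cst (\d_x B)))//.
  exact/esym/integral_probability_cst.
- exact: measurable_state.
- exact: measurable_state.
rewrite (eq_integral (cst (g x))) => [|w _]; first exact: integral_probability_cst.
by rewrite /kdirac/= integral_dirac// diracT mul1e.
Qed.

Lemma integral_next_state n (g : X -> \bar R) :
  measurable_fun setT g -> (forall z, 0 <= g z) ->
  \int[P]_w g (w n.+1).1 = \int[P]_w \int[q (w n)]_y g y.
Proof.
move=> mg g0; have [_ _ P3] := strategic_measureP q pi x.
apply: integral_disintegration => //; first exact: measurable_state.
  exact: (@measurable_coordinate _ (X * A)%type n).
move=> B mB; have := P3 n setT B measurableT mB.
rewrite (_ : [set w | setT (past n.+1 w)] = setT)// => <-; congr (P _).
by apply/seteqP; split=> [w|w []].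
Qed.

(** The strategic measure describes the law of the pair [w n] on rectangles only. These form a
    generating class closed under intersection, so agreement there gives equality of the two image
    measures. *)
Lemma integral_stationary_stage n (phi : X -> A) (g : X * A -> \bar R)
    (mphi : measurable_fun setT phi) :
  (forall h D, measurable D -> pi n h D = \d_(phi h.2) D) ->
  measurable_fun setT g -> (forall z, 0 <= g z) ->
  \int[P]_w g (w n) = \int[P]_w g ((w n).1, phi (w n).1).
Proof.
move=> pi_phi mg g0; have [_ P2 _] := strategic_measureP q pi x.
have mc := @measurable_coordinate _ (X * A)%type n.
have ms := measurable_state n.
have mps := measurableT_comp mphi ms.
have mG : measurable_fun setT (fun w : Om => ((w n).1, phi (w n).1)).
  by apply/measurable_fun_pairP; split.
transitivity (\int[pushforward P (fun w : Om => w n)]_z g z).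
  by rewrite [RHS]ge0_integral_pushforward// => z _; exact: g0.
transitivity (\int[pushforward P (fun w : Om => ((w n).1, phi (w n).1))]_z g z);
  last first.
  by rewrite [LHS]ge0_integral_pushforward// => z _; exact: g0.
apply: eq_measure_integral => C mC _.
apply: (@measure_unique _ R _ [set B `*` D | B in measurable & D in measurable]
  (fun=> setT)) => //.
- exact: measurable_prod_measurableType.
- move=> _ _ [B mB [D mD <-]] [B' mB' [D' mD' <-]]; rewrite -setXI.
  by exists (B `&` B'); [exact: measurableI|exists (D `&` D'); [exact: measurableI|]].
- by move=> _; exists setT => //; exists setT => //; rewrite setXTT.
- by apply/seteqP; split=> // z _; exists 0%N.
- move=> _ [B mB [D mD <-]].
  rewrite /pushforward/=.
  have mH : measurable [set h : n.-tuple (X * A)%type * X | B h.2].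
    have := @measurable_snd _ _ (n.-tuple (X * A)%type) X measurableT B mB.
    by rewrite setTI.
  have := P2 n _ D mH mD; rewrite /= => PBD; rewrite [LHS]PBD.
  under eq_integral do rewrite pi_phi//.
  rewrite integral_mkcond.
  transitivity (\int[P]_w \d_w [set w : Om | B (w n).1 /\ D (phi (w n).1)]).
    apply: eq_integral => w _; rewrite epatch_indic/= !diracE indicE.
    rewrite -EFinM -natrM mulnb andbC; congr (_%:R%:E); congr nat_of_bool.
    by apply/andP/idP => [[/set_mem Bw /set_mem Dw]|/set_mem[Bw Dw]];
      [apply/mem_set|split; apply/mem_set].
  rewrite integral_diracr//; apply: measurableI.
    by have := ms measurableT B mB; rewrite setTI.
  by have := mps measurableT D mD; rewrite setTI.
- move=> _; exact: le_lt_trans (probability_le1 P measurableT) (ltry _).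
Qed.

End strategic_measure_theory.

(** * Semicontinuity and inf-compactness *)

Lemma lower_semicontinuous_cvgn (T : topologicalType) (R : realType)
    (f : T -> \bar R) (s : nat -> T) (p : T) (l : R) :
  lower_semicontinuous f -> s @ \oo --> p -> l%:E < f p ->
  \forall n \near \oo, l%:E < f (s n).
Proof.
move=> lf sp /lf[V Vp Vl]; near=> n; apply: Vl; near: n; exact: sp.
Unshelve. all: by end_near. Qed.

Lemma cvgn_harmonic_ball (R : realType) (T : pseudoMetricType R) (s : nat -> T)
    (p : T) : (forall n, ball p n.+1%:R^-1 (s n)) -> s @ \oo --> p.
Proof.
move=> sp; apply/cvg_ballP => e e0.
have /cvgrPdist_lt/(_ e e0) := @cvg_harmonic R; apply: filterS => n.
rewrite /= sub0r normrN ger0_norm ?invr_ge0// => /ltW ne.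
exact: le_ball ne _ (sp n).
Qed.

(** The bridge to [weakly_continuous] and to compactness arguments, both of which speak of
    sequences. *)
Lemma lower_semicontinuous_seq (R : realType) (T : pseudoMetricType R)
    (f : T -> \bar R) :
  (forall s p (l : R), s @ \oo --> p -> (forall n : nat, f (s n) <= l%:E) ->
    f p <= l%:E) ->
  lower_semicontinuous f.
Proof.
move=> fseq x a afx; apply: contrapT => nV.
have /choice[s sP] n : exists y, ball x n.+1%:R^-1 y /\ f y <= a%:E.
  apply: contrapT => ny; apply: nV; exists (ball x n.+1%:R^-1).
    by apply: nbhsx_ballx; rewrite invr_gt0.
  by move=> y xy; rewrite ltNge; apply/negP => fya; apply: ny; exists y.
have := fseq s x a (cvgn_harmonic_ball (fun n => (sP n).1)) (fun n => (sP n).2).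
by rewrite leNgt afx.
Qed.

(** Subsequences are reindexings with [k <= n_ k], the form that a cluster point delivers
    directly. *)
Lemma cvgn_subsequence (n_ : nat -> nat) : (forall k, (k <= n_ k)%N) ->
  n_ @ \oo --> \oo.
Proof.
move=> kn; apply/cvgnyPge => N; near=> k; apply: leq_trans (kn k).
by near: k; exact: nbhs_infty_ge.
Unshelve. all: by end_near. Qed.

Lemma compact_subsequence (R : realType) (T : pseudoMetricType R) (K : set T)
    (s : nat -> T) : compact K -> (forall n, K (s n)) ->
  exists p, K p /\ exists n_ : nat -> nat,
    (forall k, (k <= n_ k)%N) /\ (s \o n_) @ \oo --> p.
Proof.
move=> cK sK; have FK : \forall n \near \oo, K (s n) by apply: nearW.
have [p [Kp clp]] := cK (s @ \oo) _ FK.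
exists p; split=> //.
have /choice[n_ nP] k : exists n, (k <= n)%N /\ ball p k.+1%:R^-1 (s n).
  have [||y [[n kn <-] py]] :=
    clp [set s n | n in [set n | (k <= n)%N]] (ball p k.+1%:R^-1).
  - by exists k => // n kn; exists n.
  - by apply: nbhsx_ballx; rewrite invr_gt0.
  - by exists n.
exists n_; split=> [k|]; first exact: (nP k).1.
exact: cvgn_harmonic_ball (fun k => (nP k).2).
Qed.

(** Supplies the compact set of states for [K_inf_compact]. A filter that does not cluster at [p]
    avoids a neighbourhood of [p], hence lives on finitely many terms of the sequence. *)
Lemma compact_cvgn_range (T : topologicalType) (s : nat -> T) (p : T) :
  s @ \oo --> p -> compact (p |` range s).
Proof.
move=> sp F PF FK; have [clp|nclp] := pselect (cluster F p).
  by exists p; split=> //; left.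
have [B [U [FB Up BU]]] : exists B U, [/\ F B, nbhs p U & B `&` U = set0].
  apply: contrapT => nBU; apply: nclp => B U FB Up.
  by apply/set0P/eqP => BU; apply: nBU; exists B, U.
have [N _ NU] := sp _ Up.
have cN : compact (s @` `I_N) by apply: finite_compact; exact: finite_image.
have [|t [[n _ <-] clt]] := cN F PF.
  apply: filterS (filterI FK FB) => t [[->|[n _ <-]] Bt].
    have : (B `&` U) p by split=> //; exact: nbhs_singleton.
    by rewrite BU.
  exists n => //=; rewrite ltnNge; apply/negP => Nn.
  have : (B `&` U) (s n) by split=> //; exact: NU.
  by rewrite BU.
by exists (s n); split=> //; right; exists n.
Qed.

Lemma lower_semicontinuous_borel (R : realType) (d : measure_display)
    (X : measurableMetricType R d) (f : X -> \bar R) :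
  @measurable d X = <<s @open X >> -> lower_semicontinuous f ->
  measurable_fun setT f.
Proof.
move=> borelX /lower_semicontinuousP lf.
apply: (@measurability _ _ X (\bar R) setT f _ (ErealGenOInfty.measurableE R)).
move=> _ [_ [r ->] <-]; rewrite setTI borelX; apply: sub_sigma_algebra.
by rewrite preimage_itvoy; exact: lf.
Qed.

(** The thresholds are real even when [a] or [b] is [+oo], so lower semicontinuity can be applied to
    each summand. *)
Lemma lte_addP (R : realType) (a b : \bar R) (l : R) : 0 <= a -> 0 <= b ->
  l%:E < a + b -> exists r1 r2 : R, [/\ r1%:E < a, r2%:E < b & (l <= r1 + r2)%R].
Proof.
case: a => [a||]; case: b => [b||]//= a0 b0.
- rewrite -EFinD lte_fin => lab; pose e := ((a + b - l) / 2)%R.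
  have e0 : (0 < e)%R by rewrite divr_gt0// subr_gt0.
  exists (a - e)%R, (b - e)%R; rewrite !lte_fin !ltrBlDr !ltrDl; split=> //.
  by rewrite /e; lra.
- move=> _; exists (a - 1)%R, (l - a + 1)%R; rewrite lte_fin ltrBlDr ltrDl ltry.
  by split=> //; lra.
- move=> _; exists (l - b + 1)%R, (b - 1)%R; rewrite lte_fin ltrBlDr ltrDl ltry.
  by split=> //; lra.
- by move=> _; exists l, 0%R; rewrite !ltry addr0.
Qed.

Lemma lower_semicontinuousD (T : topologicalType) (R : realType)
    (f g : T -> \bar R) : (forall x, 0 <= f x) -> (forall x, 0 <= g x) ->
  lower_semicontinuous f -> lower_semicontinuous g ->
  lower_semicontinuous (f \+ g).
Proof.
move=> f0 g0 lf lg x a /= /(lte_addP (f0 x) (g0 x))[r1 [r2 [r1f r2g ar]]].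
have [V Vx Vf] := lf _ _ r1f; have [W Wx Wg] := lg _ _ r2g.
exists (V `&` W); first exact: filterI.
move=> y [/Vf fy /Wg gy]; apply: (@le_lt_trans _ _ (r1 + r2)%:E).
  by rewrite lee_fin.
by rewrite EFinD lteD.
Qed.

Lemma lower_semicontinuous_sup (T : topologicalType) (R : realType)
    (f_ : nat -> T -> \bar R) : (forall n, lower_semicontinuous (f_ n)) ->
  lower_semicontinuous (fun x => ereal_sup (range (f_ ^~ x))).
Proof.
move=> lf x a /ereal_sup_gt[_ [n _ <-] /lf[V Vx Vf]].
exists V => // y /Vf; move/lt_le_trans; apply.
by apply: ereal_sup_ubound; exists n.
Qed.

(** An infimum of infinitely many lower semicontinuous functions need not be lower semicontinuous;
    equicontinuity provides one radius for all indices. *)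
Lemma lower_semicontinuous_equi_inf (R : realType) (X : metricType R)
    (f_ : nat -> X -> \bar R) (j : nat) : lower_semi_equicontinuous f_ ->
  lower_semicontinuous (fun x => ereal_inf [set f_ n x | n in [set n | (j <= n)%N]]).
Proof.
move=> ef x a; set I := ereal_inf _ => aI.
have [r ar rI] : exists2 r : R, (a < r)%R & r%:E <= I.
  case: I aI => [i||]//; last by exists (a + 1)%R; rewrite ?ltrDl// leey.
  by move=> ai; exists i.
pose e := ((r - a) / 2)%R.
have e0 : (0 < e)%R by rewrite divr_gt0// subr_gt0.
have [delta d0 fd] := ef x e e0.
exists (ball x delta); first exact: nbhsx_ballx.
move=> y /fd fy; apply: (@lt_le_trans _ _ (r - e)%:E).
  by rewrite lte_fin /e; lra.
apply: le_ereal_inf_tmp => _ [n jn <-]; apply: le_trans (ltW (fy n)).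
rewrite EFinB leeB// (le_trans rI)//; apply: ereal_inf_lbound.
by exists n.
Qed.

(** * Weak convergence and lower semicontinuous integrands *)

Section lipschitz_approximation.
Context (R : realType) (X : metricType R) (V : X -> \bar R).
Hypothesis V0 : forall x, 0 <= V x.
Hypothesis lV : lower_semicontinuous V.

Let trunc (k : nat) (y : X) : R := fine (mine (V y) k%:R%:E).

Let truncE k y : (trunc k y)%:E = mine (V y) k%:R%:E.
Proof.
rewrite fineK// fin_numE; apply/andP; split.
  by rewrite gt_eqF// lt_min ltNyr (lt_le_trans ltNy0 (V0 y)).
by rewrite lt_eqF// gt_min ltry orbT.
Qed.

Let trunc_ge0 k y : (0 <= trunc k y)%R.
Proof. by rewrite -lee_fin truncE le_min V0 lee_fin ler0n. Qed.

Let h (k : nat) (x y : X) : R := (trunc k y + k%:R * mdist x y)%R.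

(** The Pasch-Hausdorff envelope of [V] truncated at [k]. The truncation makes it bounded and the
    penalty makes it Lipschitz with constant [k], so it is an admissible test function for weak
    convergence. *)
Definition lipschitz_minorant (k : nat) (x : X) : R := inf (range (h k x)).
Local Notation g := lipschitz_minorant.

Let h_ge0 k x y : (0 <= h k x y)%R.
Proof. by rewrite addr_ge0 ?mulr_ge0 ?mdist_ge0. Qed.

Let g_le k x y : (g k x <= h k x y)%R.
Proof.
by apply: ge_inf; [exists 0%R => _ [z _ <-]|exists y].
Qed.

Let g_ge k x r : (forall y, r <= h k x y)%R -> (r <= g k x)%R.
Proof.
move=> rh; apply: lb_le_inf; first by exists (h k x x), x.
by move=> _ [y _ <-].
Qed.

Lemma lipschitz_minorant_ge0 k x : (0 <= g k x)%R.
Proof. exact: g_ge. Qed.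

Lemma lipschitz_minorant_le k x : (g k x <= k%:R)%R.
Proof.
apply: (le_trans (g_le k x x)); rewrite /h mdistxx mulr0 addr0.
by rewrite -lee_fin truncE ge_min lexx orbT.
Qed.

Lemma lipschitz_minorant_le_fun k x : (g k x)%:E <= V x.
Proof.
rewrite (@le_trans _ _ (h k x x)%:E) ?lee_fin//.
by rewrite /h mdistxx mulr0 addr0 truncE ge_min lexx.
Qed.

Lemma lipschitz_minorant_nd x : {homo (g ^~ x) : k k' / (k <= k')%N >-> (k <= k')%R}.
Proof.
move=> k k' kk'; apply: g_ge => y; apply: (le_trans (g_le k x y)).
rewrite /h lerD// ?ler_wpM2r ?mdist_ge0 ?ler_nat//.
by rewrite -lee_fin !truncE le_min ge_min lexx ge_min lee_fin ler_nat kk' orbT.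
Qed.

Let g_lipschitz k x x' : (g k x - k%:R * mdist x x' <= g k x')%R.
Proof.
apply: g_ge => y; rewrite lerBlDr; apply: (le_trans (g_le k x y)).
rewrite /h -addrA lerD2l -mulrDr ler_wpM2l// addrC.
exact: metric_triangle.
Qed.

Lemma lipschitz_minorant_continuous k : continuous (g k).
Proof.
move=> x; apply/cvgrPdist_lt => e e0.
near=> y.
have xy : (k%:R * mdist x y < e)%R.
  (* The factor [k.+1] in place of [k] permits the division when [k = 0]. *)
  rewrite (@le_lt_trans _ _ (k.+1%:R * mdist x y)%R)//.
    by rewrite ler_wpM2r ?mdist_ge0// ler_nat.
  rewrite mulrC -ltr_pdivlMr//.
  suff : ball x (e / k.+1%:R) y by rewrite ballEmdist.
  by near: y; apply: nbhsx_ballx; rewrite divr_gt0.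
have := g_lipschitz k x y; have := g_lipschitz k y x; rewrite (metric_sym y x).
rewrite ltr_norml; lra.
Unshelve. all: by end_near. Qed.

(** For real [a < V x], the points close to [x] have [V > a] by lower semicontinuity, and at the
    other points a steep penalty alone exceeds [a]. *)
Lemma lipschitz_minorant_cvg x : (fun k => (g k x)%:E) @ \oo --> V x.
Proof.
rewrite (_ : V x = ereal_sup (range (fun k => (g k x)%:E))).
  apply: ereal_nondecreasing_cvgn => k k' kk'.
  by rewrite lee_fin lipschitz_minorant_nd.
apply/eqP; rewrite eq_le; apply/andP; split; last first.
  by apply: ge_ereal_sup => _ [k _ <-]; exact: lipschitz_minorant_le_fun.
rewrite leNgt; apply/negP => supV.
have [a supa aV] : exists2 a : R, ereal_sup (range (fun k => (g k x)%:E)) < a%:E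
    & a%:E < V x.
  have sup0 : 0 <= ereal_sup (range (fun k => (g k x)%:E)).
    apply: (@le_trans _ _ (g 0%N x)%:E); first by rewrite lee_fin lipschitz_minorant_ge0.
    by apply: ereal_sup_ubound; exists 0%N.
  case: ereal_sup sup0 supV => [r||]//= _; case: (V x) => [v||]//.
    rewrite lte_fin => rv; exists ((r + v) / 2)%R; rewrite lte_fin; lra.
  by move=> _; exists (r + 1)%R; rewrite ?ltry// lte_fin ltrDl.
have [W Wx Wa] := lV aV.
have [delta/= d0 dW] := (nbhs_ballP _ _).1 Wx.
have ad0 : (0 <= `|a| / delta)%R by rewrite divr_ge0// ltW.
(* [k] must exceed [|a|], so that the truncation stays above [a], and [|a| / delta], so that the
   penalty at distance [delta] does. *)
pose k := Num.bound (`|a| + `|a| / delta)%R.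
have kgt : (`|a| + `|a| / delta < k%:R)%R by apply: archi_boundP; rewrite addr_ge0.
have : (a <= g k x)%R.
  apply: g_ge => y; have [xy|] := ltP (mdist x y) delta.
    rewrite /h -[leLHS]addr0 lerD ?mulr_ge0 ?mdist_ge0//.
    rewrite -lee_fin truncE le_min ltW ?Wa//=; last by apply: dW; rewrite ballEmdist.
    by rewrite lee_fin; have := ler_norm a; lra.
  move=> dxy; rewrite /h -[leLHS]add0r lerD//.
  apply: (@le_trans _ _ (`|a| / delta * delta)%R).
    by rewrite divfK ?gt_eqF// ler_norm.
  by apply: ler_pM => //; [exact: ltW|have := normr_ge0 a; lra].
move=> ag.
have : (g k x)%:E <= ereal_sup (range (fun k => (g k x)%:E)).
  by apply: ereal_sup_ubound; exists k.
rewrite leNgt => /negP; apply; apply: lt_le_trans supa _.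
by rewrite lee_fin.
Unshelve. all: by end_near. Qed.

End lipschitz_approximation.

Section weak_limit.
Context (R : realType) (dX dA : measure_display).
Context (X : measurableMetricType R dX) (A : measurableMetricType R dA).
Variables (q : R.-pker (X * A) ~> X).
Hypothesis borelX : @measurable dX X = <<s @open X >>.
Hypothesis wq : weakly_continuous q.

(** Weak convergence passes the bound to the limit for each bounded continuous minorant of [V];
    monotone convergence then recovers [V]. *)
Lemma lower_semicontinuous_integral (V : X -> \bar R) : (forall x, 0 <= V x) ->
  lower_semicontinuous V -> lower_semicontinuous (fun p => \int[q p]_y V y).
Proof.
move=> V0 lV; apply: lower_semicontinuous_seq => s p l sp sl.
have mV := lower_semicontinuous_borel borelX lV.
pose g := lipschitz_minorant V.
have cg k : continuous (g k) by exact: lipschitz_minorant_continuous.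
have g0 k x : 0 <= (g k x)%:E by rewrite lee_fin lipschitz_minorant_ge0.
have mg k : measurable_fun setT (fun x => (g k x)%:E).
  apply: (lower_semicontinuous_borel borelX); apply/lower_semicontinuousP => a.
  rewrite (_ : [set x | _] = g k @^-1` [set y | (a < y)%R]); last first.
    by apply/seteqP; split=> x /=; rewrite lte_fin.
  by apply: open_comp; [move=> x _; exact: cg|exact: open_gt].
have gl k : \int[q p]_x (g k x)%:E <= l%:E.
  have gb : exists M : R, forall x, (`|g k x| <= M)%R.
    exists k%:R => x; rewrite ger0_norm ?lipschitz_minorant_ge0//.
    exact: lipschitz_minorant_le.
  apply: cvge_le (wq sp (cg k) gb); apply: nearW => n.
  apply: le_trans (sl n); apply: ge0_le_integral => //.
  by move=> x _; exact: lipschitz_minorant_le_fun.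
have cvgV := @cvg_monotone_convergence _ _ _ (q p) setT measurableT
  (fun k x => (g k x)%:E) mg (fun k x _ => g0 k x).
rewrite (eq_integral (fun x => limn (fun k => (g k x)%:E))); last first.
  by move=> x _; apply/esym/cvg_lim => //; exact: lipschitz_minorant_cvg.
apply: cvge_le (cvgV _); first by apply: nearW.
by move=> x _ k k' kk'; rewrite lee_fin lipschitz_minorant_nd.
Qed.

Variable c : X * A -> \bar R.
Hypothesis infc : K_inf_compact c.

(** [K_inf_compact] controls actions over a compact set of states, here the sequence together with
    its limit; uniqueness of limits identifies the state component of the cluster point. *)
Lemma inf_compact_subsequence (x_ : nat -> X) (a_ : nat -> A) (x : X) (l : R) :
  x_ @ \oo --> x -> (forall n, c (x_ n, a_ n) <= l%:E) ->
  exists a, c (x, a) <= l%:E /\ exists n_ : nat -> nat,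
    (forall k, (k <= n_ k)%N) /\ (a_ \o n_) @ \oo --> a.
Proof.
move=> x_x cl.
have K0 : (x |` range x_) !=set0 by exists x; left.
have cR : compact (x |` range x_) by exact: compact_cvgn_range.
have cK := @infc _ K0 cR l.
have [|[y a] [[_ /= cya] [n_ [kn sya]]]] :=
  @compact_subsequence R (X * A)%type _ (fun n => (x_ n, a_ n)) cK.
  by move=> n; split=> //=; right; exists n.
have yE : y = x.
  apply: (@cvg_unique _ (@metric_hausdorff _ X) (x_ \o n_ @ \oo)).
    apply: (@cvg_comp _ _ _ (fun k => (x_ (n_ k), a_ (n_ k))) fst) sya _.
    exact: cvg_fst.
  by apply: cvg_comp x_x; exact: cvgn_subsequence.
subst y; exists a; split=> //; exists n_; split=> //.
apply: (@cvg_comp _ _ _ (fun k => (x_ (n_ k), a_ (n_ k))) snd) sya _.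
exact: cvg_snd.
Qed.

Lemma lower_semicontinuous_inf_compact : lower_semicontinuous c.
Proof.
apply: lower_semicontinuous_seq => s [x a] l sxa sl.
have s1 : (fst \o s) @ \oo --> x.
  by apply: (@cvg_comp _ _ _ s fst) sxa _; exact: cvg_fst.
have s2 : (snd \o s) @ \oo --> a.
  by apply: (@cvg_comp _ _ _ s snd) sxa _; exact: cvg_snd.
have [|b [cxb [n_ [kn ab]]]] := @inf_compact_subsequence (fst \o s) (snd \o s) x l s1.
  by move=> n; rewrite /= -surjective_pairing.
suff <- : b = a by [].
apply: (@cvg_unique _ (@metric_hausdorff _ A) ((snd \o s) \o n_ @ \oo)) => //.
by apply: cvg_comp s2; exact: cvgn_subsequence.
Qed.

Hypothesis c0 : forall z, 0 <= c z.

(* With [U_] constant, this yields the existence of minimizing actions and the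
   lower semicontinuity of the minimum. *)
Lemma inf_compact_limit (x_ : nat -> X) (a_ : nat -> A) (x : X)
    (U_ : nat -> X -> \bar R) (l_ : nat -> R) (l : R) :
  x_ @ \oo --> x -> l_ @ \oo --> l ->
  (forall j, lower_semicontinuous (U_ j)) -> (forall j y, 0 <= U_ j y) ->
  (forall y, {homo (U_ ^~ y) : j k / (j <= k)%N >-> j <= k}) ->
  (forall n j, (j <= n)%N ->
    c (x_ n, a_ n) + \int[q (x_ n, a_ n)]_y U_ j y <= (l_ n)%:E) ->
  exists a, c (x, a) + \int[q (x, a)]_y ereal_sup (range (U_ ^~ y)) <= l%:E /\
    exists n_ : nat -> nat, (forall k, (k <= n_ k)%N) /\ (a_ \o n_) @ \oo --> a.
Proof.
move=> x_x l_l lU U0 ndU cU.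
have int0 j p : 0 <= \int[q p]_y U_ j y by exact: integral_ge0.
have [M l_M] : exists M : R, forall n, (l_ n <= M)%R.
  have [M [_ MP]] := cvg_seq_bounded (cvgP _ l_l).
  exists (M + 1)%R => n; apply: le_trans (ler_norm _) _.
  by apply: (MP (M + 1)%R) => //; rewrite ltrDl.
have [n|a [_ [n_ [kn aa]]]] := @inf_compact_subsequence x_ a_ x M x_x.
  rewrite (@le_trans _ _ (l_ n)%:E) ?lee_fin//.
  apply: le_trans (cU n 0%N (leq0n n)); exact: leeDl.
exists a; split; last by exists n_.
have nn := cvgn_subsequence kn.
have sxa : (fun k => (x_ (n_ k), a_ (n_ k))) @ \oo --> (x, a).
  by apply: cvg_pair; [exact: cvg_comp nn x_x|exact: aa].
(* For fixed [j] the bound is available at every [n_ k] with [j <= k], and the cost with [U_ j] is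
   lower semicontinuous in state and action. The supremum over [j] is taken only after the limit in
   [k]. *)
have cUj j : c (x, a) + \int[q (x, a)]_y U_ j y <= l%:E.
  rewrite leNgt; apply/negP => lc.
  have [r lr rc] : exists2 r : R, (l < r)%R &
      r%:E < c (x, a) + \int[q (x, a)]_y U_ j y.
    move: lc; case: (_ + _) => [s||]//; last by exists (l + 1)%R; rewrite ?ltry ?ltrDl.
    by rewrite lte_fin => ls; exists ((l + s) / 2)%R; rewrite ?lte_fin; lra.
  have lsc := lower_semicontinuousD c0 (int0 j) lower_semicontinuous_inf_compact
    (lower_semicontinuous_integral (U0 j) (lU j)).
  have := lower_semicontinuous_cvgn lsc sxa rc => near1.
  have near2 : \forall k \near \oo, (l_ (n_ k) < r)%R.
    have /cvgrPdist_lt := cvg_comp _ _ nn l_l; move=>/(_ (r - l)%R).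
    rewrite subr_gt0 => /(_ lr); apply: filterS => k /=.
    by rewrite ltr_norml; lra.
  have near3 : \forall k \near \oo, (j <= k)%N by exact: nbhs_infty_ge.
  have [k [[r1 r2] jk]] := filter_ex (filterI (filterI near1 near2) near3).
  have := lt_le_trans r1 (cU (n_ k) j (leq_trans jk (kn k))).
  by rewrite lte_fin ltNge (ltW r2).
have mU j := lower_semicontinuous_borel borelX (lU j).
rewrite (eq_integral (fun y => limn (U_ ^~ y))); last first.
  by move=> y _; apply/esym/cvg_lim => //; exact/ereal_nondecreasing_cvgn/ndU.
have cvgU := @cvg_monotone_convergence _ _ _ (q (x, a)) setT measurableT U_ mU
  (fun j y _ => U0 j y) (fun y _ => ndU y).
have cfin : c (x, a) \is a fin_num.
  rewrite ge0_fin_numE//; apply: le_lt_trans (ltry l).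
  by apply: le_trans (cUj 0%N); exact: leeDl.
have cvgcU : (fun j => c (x, a) + \int[q (x, a)]_y U_ j y) @ \oo -->
    c (x, a) + \int[q (x, a)]_y limn (U_ ^~ y).
  by apply: cvgeD => //; [rewrite fin_num_adde_defr|exact: cvg_cst].
by apply: cvge_le cvgcU; apply: nearW => j; exact: cUj.
Qed.

End weak_limit.

(** * Measurable selection and the optimality operator *)

Lemma nested_compact (R : realType) (T : metricType R) (G : nat -> set T) :
  (forall j, compact (G j)) -> (forall j, G j !=set0) ->
  (forall j k, (j <= k)%N -> G k `<=` G j) -> \bigcap_j G j !=set0.
Proof.
move=> cG G0 ndG; have [s sG] := choice G0.
have [n|p [_ [n_ [kn sp]]]] := @compact_subsequence R T (G 0%N) s (cG 0%N).
  exact: ndG (sG n).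
exists p => j _.
apply: (@closed_cvg _ _ \oo _ (s \o n_) (G j)) sp.
  exact: compact_closed (@metric_hausdorff _ T) (cG j).
near=> k; apply: (ndG j (n_ k)) (sG _); apply: leq_trans (kn k).
by near: k; exact: nbhs_infty_ge.
Unshelve. all: by end_near. Qed.

(** The sets are the traces on [A] of closed balls with radii [1/(k+1)]. Their centres lie in the
    ambient Polish space, where the countable dense set is given; a radius below half the distance
    of two points separates them. *)
Lemma separating_closed_sequence (R : realType) (d : measure_display)
    (A : measurableMetricType R d) : borel_subset_of_polish A ->
  exists C : nat -> set A, (forall j, closed (C j)) /\
    forall a b, a <> b -> exists j, C j a /\ ~ C j b.
Proof.
move=> [_ [S [i [[D cD dD] isom _]]]].
have /countable_injP[f finj] := cD.
pose C0 (n k : nat) : set A :=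
  [set a | exists d, [/\ D d, f d = n & (mdist (i a) d <= k.+1%:R^-1)%R]].
have C0closed n k : closed (C0 n k).
  rewrite -[C0 n k]setCK closedC openE => a na.
  have [[e [De fe]]|ne] := pselect (exists e, D e /\ f e = n); last first.
    by apply/nbhs_ballP; exists 1%R => //= b _ [e [De fe _]]; apply: ne; exists e.
  have ae : (k.+1%:R^-1 < mdist (i a) e)%R.
    by rewrite ltNge; apply/negP => ae; apply: na; exists e.
  apply/nbhs_ballP; exists (mdist (i a) e - k.+1%:R^-1)%R; first by rewrite /= subr_gt0.
  move=> b; rewrite ballEmdist /= => ab [e' [De' fe' be']].
  have ee' : e' = e by apply: finj; rewrite ?inE// fe.
  subst e'; have tri := metric_triangle (i a) (i b) e; rewrite isom in tri.
  have : (mdist (i a) e < mdist (i a) e)%R.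
    apply: le_lt_trans tri _; rewrite -ltrBrDr; apply: lt_le_trans ab _.
    by rewrite lerB.
  by rewrite ltxx.
exists (fun j => if unpickle j is Some (n, k) then C0 n k else set0); split.
  by move=> j; case: unpickle => [[n k]|]; [exact: C0closed|exact: closed0].
move=> a b ab; pose r := mdist a b.
have r0 : (0 < r)%R by rewrite mdist_gt0; apply/eqP.
have [k kr] : exists k : nat, (k.+1%:R^-1 < r / 2)%R.
  exists (Num.bound (2 / r)%R); rewrite invf_plt ?posrE ?divr_gt0// invf_div.
  apply: lt_trans (archi_boundP _) _; first by rewrite divr_ge0// ltW.
  by rewrite ltr_nat.
have [||e [ae De]] := dD (interior (ball (i a) k.+1%:R^-1)).
- exists (i a); apply: nbhsx_ballx; by rewrite invr_gt0.
- exact: open_interior.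
have {}ae := interior_subset ae.
rewrite ballEmdist /= in ae.
exists (pickle (f e, k)); rewrite pickleK; split.
  by exists e; split=> //; exact: ltW.
move=> [e' [De' fe' be']].
have ee' : e' = e by apply: finj; rewrite ?inE.
subst e'; have := metric_triangle (i a) e (i b).
rewrite isom (metric_sym e) -/r.
move: kr ae be'; set eps : R := (k.+1%:R^-1)%R => kr ae be' tri.
suff : (r < r)%R by rewrite ltxx.
lra.
Qed.

Section measurable_selection.
Context (d dA : measure_display) (R : realType).
Context (T : measurableType d) (A : measurableMetricType R dA).
Hypothesis borelA : @measurable dA A = <<s @open A >>.
Variable C : nat -> set A.
Hypothesis closedC : forall j, closed (C j).
Hypothesis separatingC : forall a b, a <> b -> exists j, C j a /\ ~ C j b.
Variable Phi : T -> set A.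
Hypothesis Phi_compact : forall x, compact (Phi x).
Hypothesis Phi_nonempty : forall x, Phi x !=set0.
Hypothesis Phi_measurable : forall F, closed F ->
  measurable [set x | Phi x `&` F !=set0].

(* [shrink j x] is [Phi x] cut by those of [C 0, .., C (j - 1)] which, in turn,
   leave it nonempty; by separation only one point survives all cuts. *)
Fixpoint shrink (j : nat) (x : T) : set A :=
  if j is j'.+1 then
    shrink j' x `&` [set a | shrink j' x `&` C j' !=set0 -> C j' a]
  else Phi x.

Let shrinkS_hit j x : shrink j x `&` C j !=set0 ->
  shrink j.+1 x = shrink j x `&` C j.
Proof.
by move=> h; apply/seteqP; split=> a [sa Ca]; split=> // ; exact: Ca.
Qed.

Let shrinkS_miss j x : ~ (shrink j x `&` C j !=set0) -> shrink j.+1 x = shrink j x.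
Proof. by move=> h; apply/seteqP; split=> a; [case|move=> sa; split]. Qed.

Let shrink_compact j x : compact (shrink j x).
Proof.
elim: j => [|j IHj]; first exact: Phi_compact.
have [h|h] := pselect (shrink j x `&` C j !=set0).
  by rewrite shrinkS_hit//; exact: compact_closedI.
by rewrite shrinkS_miss.
Qed.

Let shrink_nonempty j x : shrink j x !=set0.
Proof.
elim: j => [|j IHj]; first exact: Phi_nonempty.
have [h|h] := pselect (shrink j x `&` C j !=set0).
  by rewrite shrinkS_hit.
by rewrite shrinkS_miss.
Qed.

Let shrink_nd x j k : (j <= k)%N -> shrink k x `<=` shrink j x.
Proof.
move=> /subnK <-; elim: (k - j)%N => [//|i IHi].
by rewrite addSn => a [/IHi].
Qed.

(** One more cut turns hitting [F] into either hitting the closed set [C j] intersected with [F], or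
    missing [C j] and hitting [F]. This is why the induction runs over all closed sets. *)
Let shrink_measurable j F : closed F ->
  measurable [set x | shrink j x `&` F !=set0].
Proof.
elim: j F => [|j IHj] F cF; first exact: Phi_measurable.
rewrite (_ : [set x | _] =
    ([set x | shrink j x `&` C j !=set0] `&`
       [set x | shrink j x `&` (C j `&` F) !=set0]) `|`
    (~` [set x | shrink j x `&` C j !=set0] `&`
       [set x | shrink j x `&` F !=set0])).
  apply: measurableU; apply: measurableI; try exact: IHj.
  - by apply: IHj; exact: closedI.
  - by apply: measurableC; exact: IHj.
apply/seteqP; split=> x.
  move=> hx; have {hx} : shrink j.+1 x `&` F !=set0 by [].
  have [h|h] := pselect (shrink j x `&` C j !=set0).
    by rewrite shrinkS_hit// -setIA; left.
  by rewrite shrinkS_miss//; right.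
move=> [[h]|[h]] hx; suff: shrink j.+1 x `&` F !=set0 by [].
  by rewrite shrinkS_hit// -setIA.
by rewrite shrinkS_miss.
Qed.

(** The nested compact sets [shrink j x] have exactly one common point, which is [phi x]. By
    compactness it lies in a closed [F] as soon as every [shrink j x] meets [F], so the preimage of
    [F] is a countable intersection of measurable sets. *)
Lemma measurable_selection : exists phi : T -> A,
  measurable_fun setT phi /\ forall x, Phi x (phi x).
Proof.
have /choice[phi phiP] x : exists a, forall j, shrink j x a.
  have [a aP] := nested_compact (shrink_compact ^~ x) (shrink_nonempty ^~ x)
    (@shrink_nd x).
  by exists a => j; exact: aP.
have uniq_phi x a : (forall j, shrink j x a) -> a = phi x.
  move=> ha; apply: contrapT => /separatingC[j [Ca nCphi]].
  have [_ h] := phiP x j.+1.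
  by apply: nCphi; apply: h; exists a; split; [exact: ha|exact: Ca].
have preim F : closed F -> phi @^-1` F = \bigcap_j [set x | shrink j x `&` F !=set0].
  move=> cF; apply/seteqP; split=> [x Fx j _|x hx]; first by exists (phi x).
  have [||a aP] := @nested_compact R A (fun j => shrink j x `&` F) _ (hx ^~ I).
  - by move=> j; exact: compact_closedI.
  - by move=> j k jk a [/(shrink_nd jk)].
  rewrite /preimage /= -(uniq_phi x a); first by have [] := aP 0%N I.
  by move=> j; have [] := aP j I.
exists phi; split; last by move=> x; exact: (phiP x 0%N).
apply: (@measurability _ _ T A setT phi (@open A) borelA).
move=> _ [U oU <-]; rewrite setTI.
have -> : phi @^-1` U = ~` (\bigcap_j [set x | shrink j x `&` ~` U !=set0]).
  rewrite -preim; last exact: open_closedC.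
  by rewrite -preimage_setC setCK.
apply: measurableC; apply: bigcapT_measurable => j.
by apply: shrink_measurable; exact: open_closedC.
Qed.

End measurable_selection.

Section optimality_operator.
Context (R : realType) (dX dA : measure_display).
Context (X : measurableMetricType R dX) (A : measurableMetricType R dA).
Variables (c : X * A -> \bar R) (q : R.-pker (X * A) ~> X).
Hypothesis X_borel : borel_subset_of_polish X.
Hypothesis A_borel : borel_subset_of_polish A.
Hypothesis infc : K_inf_compact c.
Hypothesis wq : weakly_continuous q.
Hypothesis c0 : forall z, 0 <= c z.

Definition action_cost (V : X -> \bar R) (p : X * A) : \bar R :=
  c p + \int[q p]_y V y.

(** The constraint serves measurability of the minimizers: where the minimum is finite, some
    minimizer lies in a closed [F] exactly when [constrained_min V F x <= bellman V x]. *)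
Definition constrained_min (V : X -> \bar R) (F : set A) (x : X) : \bar R :=
  ereal_inf [set action_cost V (x, a) | a in F].

Definition bellman (V : X -> \bar R) : X -> \bar R := constrained_min V setT.

Let borelX := X_borel.1.

Variable V : X -> \bar R.
Hypothesis V0 : forall y, 0 <= V y.
Hypothesis lV : lower_semicontinuous V.

Lemma action_cost_ge0 p : 0 <= action_cost V p.
Proof. by rewrite adde_ge0// integral_ge0. Qed.

Lemma constrained_min_ge0 F x : 0 <= constrained_min V F x.
Proof. by apply: le_ereal_inf_tmp => _ [a _ <-]; exact: action_cost_ge0. Qed.

Lemma bellman_ge0 x : 0 <= bellman V x.
Proof. exact: constrained_min_ge0. Qed.

Lemma bellman_le x a : bellman V x <= action_cost V (x, a).
Proof. by apply: ereal_inf_lbound; exists a. Qed.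

(** A constant sequence of states gives attainment of the minimum, a convergent one its lower
    semicontinuity. *)
Lemma constrained_min_limit F (s : nat -> X) x (l : R) : closed F ->
  s @ \oo --> x -> (forall n, constrained_min V F (s n) <= l%:E) ->
  exists a, F a /\ action_cost V (x, a) <= l%:E.
Proof.
move=> cF sx sl.
(* No minimizer is known yet; actions within [1/(n+1)] of the bound suffice, since
   [inf_compact_limit] allows bounds that vary with [n]. *)
have /choice[a aP] n : exists a, F a /\
    action_cost V (s n, a) <= (l + n.+1%:R^-1)%:E.
  have /ereal_inf_lt[_ [a Fa <-] /ltW al] :
      constrained_min V F (s n) < (l + n.+1%:R^-1)%:E.
    by rewrite (le_lt_trans (sl n))// lte_fin ltrDl invr_gt0.
  by exists a.
have lcvg : (fun n : nat => l + n.+1%:R^-1)%R @ \oo --> l.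
  by rewrite -[X in _ --> X]addr0; apply: cvgD; [exact: cvg_cst|exact: cvg_harmonic].
have [||b [bl [n_ [kn ab]]]] := @inf_compact_limit R dX dA X A q borelX wq c infc c0
  s a x (fun=> V) _ l sx lcvg (fun=> lV) (fun=> V0).
- by move=> y j k _.
- by move=> n j _; exact: (aP n).2.
exists b; split.
  apply: (@closed_cvg _ _ \oo _ (a \o n_) F) ab => //.
  by apply: nearW => k; exact: (aP _).1.
move: bl; rewrite /action_cost; congr (_ + _ <= _).
apply: eq_integral => y _; rewrite (_ : range _ = [set V y]) ?ereal_sup1//.
by apply/seteqP; split=> [_ [_ _ <-]//|_ ->]; exists 0%N.
Qed.

Lemma lower_semicontinuous_constrained_min F : closed F ->
  lower_semicontinuous (constrained_min V F).
Proof.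
move=> cF; apply: lower_semicontinuous_seq => s x l sx sl.
have [a [Fa al]] := constrained_min_limit cF sx sl.
by apply: le_trans al; apply: ereal_inf_lbound; exists a.
Qed.

Lemma lower_semicontinuous_bellman : lower_semicontinuous (bellman V).
Proof. exact: lower_semicontinuous_constrained_min closedT. Qed.

Lemma constrained_min_attained F x : closed F -> constrained_min V F x < +oo ->
  exists a, F a /\ action_cost V (x, a) <= constrained_min V F x.
Proof.
move=> cF moo.
have mfin : constrained_min V F x \is a fin_num.
  by rewrite ge0_fin_numE// constrained_min_ge0.
rewrite -(fineK mfin).
apply: (@constrained_min_limit F (fun=> x)) => //; first exact: cvg_cst.
by move=> n; rewrite fineK.
Qed.

(** Where the minimum is [+oo] every action attains it, but the set of all actions need not be
    compact; a fixed singleton keeps the values compact. *)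
Let argmin (x : X) : set A :=
  if bellman V x < +oo then [set a | action_cost V (x, a) <= bellman V x]
  else [set point].

Let argmin_compact x : compact (argmin x).
Proof.
rewrite /argmin; have [boo|_] := ltP (bellman V x) +oo; last exact: compact_set1.
suff: compact [set a | action_cost V (x, a) <= bellman V x] by [].
have bfin : bellman V x \is a fin_num by rewrite ge0_fin_numE// bellman_ge0.
(* The integral being nonnegative, a minimizer [a] satisfies [c (x, a) <= bellman V x], which
   confines it to the projection of a compact sublevel set. *)
have cK := @infc [set x] (ex_intro _ x erefl) (@compact_set1 _ x)
  (fine (bellman V x)).
have csnd : continuous (@snd X A) by move=> p; exact: cvg_snd.
have cK2 := continuous_compact (continuous_subspaceT csnd) cK.
have lac : lower_semicontinuous (action_cost V).
  apply: lower_semicontinuousD => //.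
  - by move=> p; exact: integral_ge0.
  - exact: lower_semicontinuous_inf_compact.
  - exact: lower_semicontinuous_integral.
apply: (subclosed_compact _ cK2).
  rewrite -[X in closed X]setCK closedC openE => a.
  move=> /negP; rewrite -ltNge -[X in X < _](fineK bfin) => /lac[W Wxa Wl].
  have : nbhs a (fun b => W (x, b)).
    apply: (@cvg_pair _ _ _ _ _ _ _ _ _ (fun=> x) id) Wxa => //.
    exact: cvg_cst.
  apply: filterS => b /Wl; rewrite fineK// => bW /= bl.
  by move: bW; rewrite ltNge bl.
move=> a /= ab; exists (x, a) => //; split=> //=.
rewrite fineK//; apply: le_trans ab; rewrite leeDl//; exact: integral_ge0.
Qed.

Let argmin_nonempty x : argmin x !=set0.
Proof.
rewrite /argmin; have [boo|_] := ltP (bellman V x) +oo; last by exists point.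
by have [a [_ ab]] := constrained_min_attained closedT boo; exists a.
Qed.

Let argmin_measurable F : closed F -> measurable [set x | argmin x `&` F !=set0].
Proof.
move=> cF.
have mb : measurable_fun setT (bellman V).
  exact: lower_semicontinuous_borel lower_semicontinuous_bellman.
have mF : measurable_fun setT (constrained_min V F).
  exact: lower_semicontinuous_borel (lower_semicontinuous_constrained_min cF).
have mfin : measurable [set x | bellman V x < +oo].
  by rewrite -[X in measurable X]setTI; exact: emeasurable_fun_infty_o.
have mle : measurable [set x | constrained_min V F x <= bellman V x].
  by rewrite -[X in measurable X]setTI; exact: measurable_lee.
rewrite (_ : [set x | _] =
    ([set x | bellman V x < +oo] `&`
     [set x | constrained_min V F x <= bellman V x]) `|`
    (~` [set x | bellman V x < +oo] `&` [set x | F point])).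
  apply: measurableU; apply: measurableI => //; first exact: measurableC.
  have [Fp|Fp] := pselect (F point).
    by rewrite (_ : [set _ | _] = setT)//; apply/seteqP; split.
  by rewrite (_ : [set _ | _] = set0)//; apply/seteqP; split.
apply/seteqP; split=> x /=; rewrite /argmin.
  have [boo|boo] := ltP (bellman V x) +oo.
    move=> [a [/= ab Fa]]; left; split=> //; apply: le_trans ab.
    by apply: ereal_inf_lbound; exists a.
  by move=> [a [/= -> Fp]]; right; split=> //; apply/negP; rewrite -leNgt.
move=> [[boo Fb]|[/negP/negbTE boo Fp]].
  have [a [Fa ab]] := constrained_min_attained cF (le_lt_trans Fb boo).
  by rewrite boo; exists a; split=> //=; exact: le_trans ab Fb.
by rewrite boo; exists point.
Qed.

Lemma bellman_selector : exists phi : X -> A, measurable_fun setT phi /\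
  forall x, action_cost V (x, phi x) = bellman V x.
Proof.
have [C [cC sepC]] := separating_closed_sequence A_borel.
have [phi [mphi phiP]] := measurable_selection A_borel.1 cC sepC argmin_compact
  argmin_nonempty argmin_measurable.
exists phi; split=> // x; apply/eqP; rewrite eq_le bellman_le andbT.
have := phiP x; rewrite /argmin /=.
by have [//|boo _] := ltP (bellman V x) +oo; exact: le_trans (leey _) boo.
Qed.

End optimality_operator.

(** * Value iteration *)

Section stage_costs.
Context (R : realType) (dX dA : measure_display).
Context (X : measurableMetricType R dX) (A : measurableMetricType R dA).
Variables (c : X * A -> \bar R) (q : R.-pker (X * A) ~> X).
Hypothesis mc : measurable_fun setT c.
Hypothesis c0 : forall z, 0 <= c z.
Implicit Types (pi : @policy R dX dA X A) (x : X) (alpha : R).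
Local Notation Om := (trajectory (X * A)%type).

Definition expected_cost pi x (t : nat) : \bar R :=
  \int[strategic_measure q pi x]_w c (w t).

Let mct t : measurable_fun setT (fun w : Om => c (w t)).
Proof. exact: measurableT_comp mc (@measurable_coordinate _ (X * A)%type t). Qed.

Lemma expected_cost_ge0 pi x t : 0 <= expected_cost pi x t.
Proof. exact: integral_ge0. Qed.

Let weighted_cost_ge0 alpha t (w : Om) :
  (0 <= alpha)%R -> 0 <= (alpha ^+ t)%:E * c (w t).
Proof. by move=> a0; rewrite mule_ge0// lee_fin exprn_ge0. Qed.

Let measurable_weighted_cost alpha t :
  measurable_fun setT (fun w : Om => (alpha ^+ t)%:E * c (w t)).
Proof. exact: measurable_funeM. Qed.

Lemma finite_horizon_costE N alpha pi x : (0 <= alpha)%R ->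
  finite_horizon_cost c q N alpha pi x =
  \sum_(0 <= t < N) (alpha ^+ t)%:E * expected_cost pi x t.
Proof.
move=> a0; rewrite /finite_horizon_cost ge0_integral_sum//; last first.
  by move=> t w _; exact: weighted_cost_ge0.
by apply: eq_bigr => t _; rewrite ge0_integralZl_EFin// exprn_ge0.
Qed.

Lemma discounted_costE alpha pi x : (0 <= alpha)%R ->
  discounted_cost c q alpha pi x =
  \sum_(0 <= t <oo) (alpha ^+ t)%:E * expected_cost pi x t.
Proof.
move=> a0; rewrite /discounted_cost integral_nneseries//; last first.
  by move=> t w _; exact: weighted_cost_ge0.
by apply: eq_eseriesr => t _; rewrite ge0_integralZl_EFin// exprn_ge0.
Qed.

Section one_step.
Variables (pi : @policy R dX dA X A) (x : X) (V U : X -> \bar R).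
Hypotheses (mV : measurable_fun setT V) (V0 : forall y, 0 <= V y).
Hypotheses (mU : measurable_fun setT U) (U0 : forall y, 0 <= U y).
Local Notation P := (strategic_measure q pi x).

Let mintU : measurable_fun setT (fun z => \int[q z]_y U y).
Proof. by apply: measurable_fun_integral_kernel => //; exact: measurable_kernel. Qed.

Let mcost : measurable_fun setT (action_cost c q U).
Proof. exact: emeasurable_funD. Qed.

Let cost_ge0 z : 0 <= action_cost c q U z.
Proof. exact: action_cost_ge0. Qed.

Let integral_action_cost n :
  \int[P]_w action_cost c q U (w n) =
  expected_cost pi x n + \int[P]_w U (w n.+1).1.
Proof.
rewrite /action_cost ge0_integralD//; first by rewrite -integral_next_state.
  by move=> w _; exact: integral_ge0.
exact: measurableT_comp mintU (@measurable_coordinate _ (X * A)%type n).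
Qed.

Lemma expected_value_le n : (forall y a, V y <= action_cost c q U (y, a)) ->
  \int[P]_w V (w n).1 <= expected_cost pi x n + \int[P]_w U (w n.+1).1.
Proof.
move=> VU; rewrite -integral_action_cost; apply: ge0_le_integral => //.
- exact: measurableT_comp mV (@measurable_state _ _ _ X A n).
- exact: measurableT_comp mcost (@measurable_coordinate _ (X * A)%type n).
- by move=> w _; case: (w n) => y a; exact: VU.
Qed.

Lemma expected_value_stationary n (phi : X -> A) : measurable_fun setT phi ->
  (forall k h D, measurable D -> pi k h D = \d_(phi h.2) D) ->
  (forall y, V y = action_cost c q U (y, phi y)) ->
  \int[P]_w V (w n).1 = expected_cost pi x n + \int[P]_w U (w n.+1).1.
Proof.
move=> mphi pi_phi VU; rewrite -integral_action_cost.
rewrite (@integral_stationary_stage _ _ _ X A q pi x n phi _ mphi (pi_phi n) mcost)//.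
by apply: eq_integral => w _; exact: VU.
Qed.

End one_step.

Lemma measurable_stationary_decision t (phi : X -> A) : measurable_fun setT phi ->
  measurable_fun setT (fun h : t.-tuple (X * A)%type * X => phi h.2).
Proof. by move=> mphi; exact: measurableT_comp mphi measurable_snd. Qed.

Definition stationary_policy (phi : X -> A) (mphi : measurable_fun setT phi) :
  @policy R dX dA X A := fun t => kdirac (@measurable_stationary_decision t phi mphi).

End stage_costs.

Lemma lower_semicontinuousZ (T : topologicalType) (R : realType) (r : R)
    (f : T -> \bar R) : (0 <= r)%R -> (forall x, 0 <= f x) ->
  lower_semicontinuous f -> lower_semicontinuous (fun x => r%:E * f x).
Proof.
rewrite le_eqVlt => /predU1P[<-|r0] f0 lf x a.
  rewrite mul0e => a0; exists setT; first exact: filterT.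
  by move=> y _; rewrite mul0e.
move=> axr; have /lf[V Vx Vf] : (r^-1 * a)%:E < f x.
  by rewrite EFinM muleC lte_pdivrMr// muleC.
exists V => // y /Vf; by rewrite EFinM muleC lte_pdivrMr// muleC.
Qed.

Section value_iteration.
Context (R : realType) (dX dA : measure_display).
Context (X : measurableMetricType R dX) (A : measurableMetricType R dA).
Variables (c : X * A -> \bar R) (q : R.-pker (X * A) ~> X).
Hypothesis X_borel : borel_subset_of_polish X.
Hypothesis A_borel : borel_subset_of_polish A.
Hypothesis mc : measurable_fun setT c.
Hypothesis infc : K_inf_compact c.
Hypothesis wq : weakly_continuous q.
Hypothesis c0 : forall z, 0 <= c z.
Variable alpha : R.
Hypothesis alpha0 : (0 <= alpha)%R.

Local Notation B := (bellman c q).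

Fixpoint value_iterate (k : nat) : X -> \bar R :=
  if k is k'.+1 then B (fun y => alpha%:E * value_iterate k' y) else cst 0.
Local Notation vi := value_iterate.

Definition value_limit (x : X) : \bar R := ereal_sup (range (vi ^~ x)).

Let vi_ge0 k x : 0 <= vi k x.
Proof.
case: k => [//|k]; apply: bellman_ge0 => // y.
elim: k y => [|k IHk] y; first by rewrite mule0.
by rewrite mule_ge0// bellman_ge0.
Qed.

Let avi_ge0 k x : 0 <= alpha%:E * vi k x.
Proof. by rewrite mule_ge0. Qed.

Let lvi k : lower_semicontinuous (vi k).
Proof.
elim: k => [|k IHk] /=.
  by move=> x a a0; exists setT => //; exact: filterT.
apply: lower_semicontinuous_bellman => //.
exact: lower_semicontinuousZ.
Qed.

Let lavi k : lower_semicontinuous (fun y => alpha%:E * vi k y).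
Proof. exact: lower_semicontinuousZ. Qed.

Lemma le_bellman (V W : X -> \bar R) : (forall y, 0 <= V y) ->
  measurable_fun setT V -> measurable_fun setT W ->
  (forall y, V y <= W y) -> forall x, B V x <= B W x.
Proof.
move=> V0 mV mW VW x; apply: le_ereal_inf_tmp => _ [a _ <-].
apply: le_trans (bellman_le _ _ _ _ a) _.
by rewrite leeD2l//; apply: ge0_le_integral.
Qed.

Let mvi k : measurable_fun setT (vi k).
Proof. exact: (lower_semicontinuous_borel X_borel.1 (@lvi k)). Qed.

Let mavi k : measurable_fun setT (fun y => alpha%:E * vi k y).
Proof. exact/measurable_funeM/mvi. Qed.

Let vi_nd x : {homo (vi ^~ x) : j k / (j <= k)%N >-> j <= k}.
Proof.
apply/nondecreasing_seqP => k; elim: k x => [|k IHk] x; first exact: vi_ge0.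
apply: (le_bellman (avi_ge0 k) (@mavi k) (@mavi k.+1)) => y.
by apply: lee_wpmul2l; [rewrite lee_fin|exact: IHk].
Qed.

Let avi_nd x : {homo ((fun j y => alpha%:E * vi j y) ^~ x) : j k / (j <= k)%N >-> j <= k}.
Proof. by move=> j k jk; apply: lee_wpmul2l; [rewrite lee_fin|exact: vi_nd]. Qed.

Lemma value_limit_ge0 x : 0 <= value_limit x.
Proof. by apply: (@le_trans _ _ (vi 0 x)) => //; apply: ereal_sup_ubound; exists 0%N. Qed.

Lemma lower_semicontinuous_value_limit : lower_semicontinuous value_limit.
Proof. exact: lower_semicontinuous_sup. Qed.

Lemma measurable_value_limit : measurable_fun setT value_limit.
Proof.
exact: (lower_semicontinuous_borel X_borel.1 lower_semicontinuous_value_limit).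
Qed.

Let alimitE y : alpha%:E * value_limit y =
  ereal_sup (range ((fun j y => alpha%:E * vi j y) ^~ y)).
Proof.
rewrite -ereal_supZl//; last by apply/set0P; exists (vi 0 y), 0%N.
by rewrite image_comp.
Qed.

(** The inequality from right to left exchanges a minimum with an increasing limit. The minimizers
    of the iterates accumulate at some action, and that action bounds the minimum for the limit. *)
Lemma value_limit_bellman x : value_limit x = B (fun y => alpha%:E * value_limit y) x.
Proof.
have mal : measurable_fun setT (fun y => alpha%:E * value_limit y).
  exact/measurable_funeM/measurable_value_limit.
apply/eqP; rewrite eq_le; apply/andP; split.
  apply: ge_ereal_sup => _ [[|k] _ <-].
    by apply: bellman_ge0 => // y; rewrite mule_ge0// value_limit_ge0.
  apply: (le_bellman (avi_ge0 k) (@mavi k) mal) => y.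
  apply: lee_wpmul2l; first by rewrite lee_fin.
  by apply: ereal_sup_ubound; exists k.
have [boo|] := ltP (value_limit x) +oo; last by rewrite leye_eq => /eqP ->; rewrite leey.
have lfin : value_limit x \is a fin_num by rewrite ge0_fin_numE// value_limit_ge0.
have vi_le k : vi k x <= value_limit x by apply: ereal_sup_ubound; exists k.
have /choice[a aP] n : exists a, action_cost c q (fun y => alpha%:E * vi n y) (x, a)
    <= value_limit x.
  have [|a [_ al]] := @constrained_min_attained _ _ _ X A c q X_borel infc wq c0 _
    (avi_ge0 n) (@lavi n) setT x closedT.
    exact: le_lt_trans (vi_le n.+1) boo.
  by exists a; apply: le_trans al (vi_le n.+1).
have [|n j jn|b [bl _]] := @inf_compact_limit R dX dA X A q X_borel.1 wq c infc c0
  (fun=> x) a x (fun j y => alpha%:E * vi j y) (fun=> fine (value_limit x))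
  (fine (value_limit x)) (cvg_cst _) (cvg_cst _) lavi avi_ge0.
- exact: avi_nd.
- rewrite fineK//; apply: le_trans (aP n).
  by rewrite leeD2l//; apply: ge0_le_integral => // y _; exact: avi_nd.
rewrite fineK// in bl; apply: le_trans bl.
apply: le_trans (bellman_le _ _ _ _ b) _; rewrite /action_cost leeD2l//.
by under eq_integral do rewrite alimitE.
Qed.

Lemma value_iterate_le_cost pi x k :
  vi k x <= \sum_(0 <= t < k) (alpha ^+ t)%:E * expected_cost c q pi x t.
Proof.
(* Induction on the number of stages already played under [pi], the remaining [j] stages being
   valued by the iterate. At [j = 0] the last term vanishes. *)
have H n j : (n + j = k)%N -> vi k x <=
    \sum_(0 <= t < n) (alpha ^+ t)%:E * expected_cost c q pi x t +
    (alpha ^+ n)%:E * \int[strategic_measure q pi x]_w vi j (w n).1.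
  elim: n j => [|n IHn] j nj.
    rewrite big_geq// add0e expr0 mul1e integral_initial_state.
    - by rewrite -nj.
    - exact: mvi.
    - exact: vi_ge0.
  rewrite (le_trans (IHn j.+1 _))//; first by rewrite -nj addnS.
  have mj := measurableT_comp (@mvi j) (@measurable_state _ _ _ X A n.+1).
  have aint : alpha%:E * \int[strategic_measure q pi x]_w vi j (w n.+1).1 =
      \int[strategic_measure q pi x]_w (alpha%:E * vi j (w n.+1).1).
    by rewrite ge0_integralZl_EFin.
  rewrite big_nat_recr//= -addeA leeD2l//.
  rewrite exprS [in leRHS]mulrC EFinM -muleA.
  rewrite aint.
  rewrite -ge0_muleDr//; [|exact: expected_cost_ge0|exact: integral_ge0].
  apply: lee_wpmul2l; first by rewrite lee_fin exprn_ge0.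
  apply: (@expected_value_le _ _ _ X A c q mc c0 pi x (vi j.+1) _
    (@mvi j.+1) (vi_ge0 j.+1) (@mavi j) (avi_ge0 j)).
  by move=> y a; exact: bellman_le.
by have := H k 0%N (addn0 k); rewrite /= integral0 mule0 adde0.
Qed.

Lemma value_limit_le_cost pi x : value_limit x <= discounted_cost c q alpha pi x.
Proof.
rewrite discounted_costE//; apply: ge_ereal_sup => _ [k _ <-].
apply: le_trans (value_iterate_le_cost pi x k) _.
apply: nneseries_lim_ge => t _ _.
by rewrite mule_ge0 ?expected_cost_ge0// lee_fin exprn_ge0.
Qed.

(** The optimality equation is iterated along a selector of minimizers. The remainder, the
    discounted expected value at time [n], is dropped by nonnegativity, so the equation need not
    have a unique solution. *)
Lemma value_limit_attained x :
  exists pi, discounted_cost c q alpha pi x <= value_limit x.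
Proof.
have al0 y : 0 <= alpha%:E * value_limit y by rewrite mule_ge0// value_limit_ge0.
have lal : lower_semicontinuous (fun y => alpha%:E * value_limit y).
  apply: lower_semicontinuousZ => //; first exact: value_limit_ge0.
  exact: lower_semicontinuous_value_limit.
have mal : measurable_fun setT (fun y => alpha%:E * value_limit y).
  exact/measurable_funeM/measurable_value_limit.
have [phi [mphi phiP]] := bellman_selector X_borel A_borel infc wq c0 al0 lal.
exists (stationary_policy mphi); set pi := stationary_policy mphi.
have H n : value_limit x =
    \sum_(0 <= t < n) (alpha ^+ t)%:E * expected_cost c q pi x t +
    (alpha ^+ n)%:E * \int[strategic_measure q pi x]_w value_limit (w n).1.
  elim: n => [|n IHn].
    rewrite big_geq// add0e expr0 mul1e integral_initial_state//.
      exact: measurable_value_limit.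
    exact: value_limit_ge0.
  have mj := measurableT_comp measurable_value_limit (@measurable_state _ _ _ X A n.+1).
  have aint : alpha%:E * \int[strategic_measure q pi x]_w value_limit (w n.+1).1 =
      \int[strategic_measure q pi x]_w (alpha%:E * value_limit (w n.+1).1).
    by rewrite ge0_integralZl_EFin// => w _; exact: value_limit_ge0.
  rewrite [LHS]IHn big_nat_recr//= -addeA; congr (_ + _).
  rewrite exprS [in RHS]mulrC EFinM -muleA.
  rewrite aint.
  rewrite -ge0_muleDr//; [|exact: expected_cost_ge0|exact: integral_ge0].
  congr (_ * _); apply: (@expected_value_stationary _ _ _ X A c q mc c0 pi x
    value_limit (fun y => alpha%:E * value_limit y) mal al0 n phi mphi) => //.
  by move=> y; rewrite phiP -value_limit_bellman.
rewrite discounted_costE//; apply: lime_le.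
  apply: is_cvg_nneseries => t _ _.
  by rewrite mule_ge0 ?expected_cost_ge0// lee_fin exprn_ge0.
apply: nearW => n; rewrite [leRHS](H n) leeDl// mule_ge0//.
  by rewrite lee_fin exprn_ge0.
by apply: integral_ge0 => w _; exact: value_limit_ge0.
Qed.

Lemma discounted_valueE : discounted_value c q alpha = value_limit.
Proof.
apply/funext => x; apply/eqP; rewrite eq_le; apply/andP; split.
  have [pi pil] := value_limit_attained x; apply: le_trans pil.
  by apply: ereal_inf_lbound; exists pi.
by apply: le_ereal_inf_tmp => _ [pi _ <-]; exact: value_limit_le_cost.
Qed.

Lemma discounted_value_ge0 x : 0 <= discounted_value c q alpha x.
Proof. by rewrite discounted_valueE value_limit_ge0. Qed.

Lemma lower_semicontinuous_discounted_value :
  lower_semicontinuous (discounted_value c q alpha).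
Proof. rewrite discounted_valueE; exact: lower_semicontinuous_value_limit. Qed.

Lemma discounted_value_bellman x : discounted_value c q alpha x =
  B (fun y => alpha%:E * discounted_value c q alpha y) x.
Proof. rewrite discounted_valueE; exact: value_limit_bellman. Qed.

End value_iteration.

(** * Abelian theorem and uniform integrability *)

Lemma limn_esup_lt (R : realType) (f : nat -> \bar R) (l : \bar R) :
  limn_esup f < l -> \forall n \near \oo, f n < l.
Proof.
move=> /ereal_inf_lt[_ [V VN <-] Vl]; apply: filterS VN => n Vn.
by apply: le_lt_trans Vl; apply: ereal_sup_ubound; exists n.
Qed.

Lemma limn_esup_le (R : realType) (f : nat -> \bar R) (l : \bar R) :
  (\forall n \near \oo, f n <= l) -> limn_esup f <= l.
Proof.
move=> fl; apply: ge_ereal_inf; exists (ereal_sup (f @` [set n | f n <= l])).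
  by exists [set n | f n <= l].
by apply: ge_ereal_sup => _ [n /= fnl <-].
Qed.

Section abel_summation.
Context (R : realType).

(* With [D N = C + \sum_(t < N) (L - r t) >= 0], summation by parts shows that
   [C + \sum_(t < N) alpha ^+ t * (L - r t) >= alpha ^+ N * D N]. *)
Lemma abel_bound (r : nat -> R) (C L alpha : R) : (0 <= alpha <= 1)%R ->
  (forall N, \sum_(0 <= t < N) r t <= C + L * N%:R)%R ->
  forall N, (\sum_(0 <= t < N) alpha ^+ t * r t <=
    C + L * \sum_(0 <= t < N) alpha ^+ t)%R.
Proof.
move=> /andP[a0 a1] rCL N.
pose D n := (C + L * n%:R - \sum_(0 <= t < n) r t)%R.
have D0 n : (0 <= D n)%R by rewrite subr_ge0.
suff : (alpha ^+ N * D N <= C + L * \sum_(0 <= t < N) alpha ^+ t -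
    \sum_(0 <= t < N) alpha ^+ t * r t)%R.
  by move=> /(le_trans (mulr_ge0 (exprn_ge0 N a0) (D0 N))); rewrite subr_ge0.
elim: N => [|n IHn]; first by rewrite expr0 /D !big_geq//; lra.
rewrite !big_nat_recr//=.
have -> : (C + L * (\sum_(0 <= t < n) alpha ^+ t + alpha ^+ n) -
    (\sum_(0 <= t < n) alpha ^+ t * r t + alpha ^+ n * r n) =
    C + L * \sum_(0 <= t < n) alpha ^+ t - \sum_(0 <= t < n) alpha ^+ t * r t +
    alpha ^+ n * (L - r n))%R by ring.
apply: (@le_trans _ _ (alpha ^+ n * D n + alpha ^+ n * (L - r n))%R); last first.
  by rewrite lerD2r.
have -> : (alpha ^+ n * D n + alpha ^+ n * (L - r n) = alpha ^+ n * D n.+1)%R.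
  by rewrite /D big_nat_recr//= -natr1; ring.
by rewrite ler_wpM2r// exprSr ler_piMr// exprn_ge0.
Qed.

Lemma geometric_sum_le (alpha : R) N : (0 <= alpha < 1)%R ->
  ((1 - alpha) * \sum_(0 <= t < N) alpha ^+ t <= 1)%R.
Proof.
move=> /andP[a0 a1]; have := subrX1 alpha N; rewrite big_mkord => aN.
have := exprn_ge0 N a0; nra.
Qed.

End abel_summation.

(** The partial sums exceed [L * N] by at most a constant, and Abel summation carries this over to
    discounted sums. [C] is chosen before [alpha], so [(1 - alpha) * C] vanishes as [alpha] tends to
    1. *)
Lemma discounted_cost_average (R : realType) (dX dA : measure_display)
    (X : measurableMetricType R dX) (A : measurableMetricType R dA)
    (c : X * A -> \bar R) (q : R.-pker (X * A) ~> X)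
    (pi : @policy R dX dA X A) (x : X) (L : R) :
  measurable_fun setT c -> (forall z, 0 <= c z) ->
  average_cost c q pi x < L%:E ->
  exists C : R, forall alpha, (0 <= alpha < 1)%R ->
    (1 - alpha)%:E * discounted_cost c q alpha pi x <= ((1 - alpha) * C + L)%:E.
Proof.
move=> mc c0 avgL; pose e := expected_cost c q pi x.
have e0 t : 0 <= e t by exact: expected_cost_ge0.
pose S N := \sum_(0 <= t < N) e t.
have S0 N : 0 <= S N by apply: sume_ge0.
have SE N : finite_horizon_cost c q N 1 pi x = S N.
  rewrite finite_horizon_costE//; apply: eq_bigr => t _.
  by rewrite expr1n mul1e.
have S_nd N M : (N <= M)%N -> S N <= S M.
  by move=> NM; apply: lee_sum_nneg_natr.
have [N0 _ avgN] := limn_esup_lt avgL.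
have SL N : (N0 < N)%N -> S N <= (L * N%:R)%:E.
  move=> N0N; have := ltW (avgN N (ltnW N0N)); rewrite SE.
  rewrite lee_pdivrMl ?ltr0n ?(leq_trans _ N0N)// => /le_trans; apply.
  by rewrite -EFinM mulrC.
have Sfin N : S N \is a fin_num.
  rewrite ge0_fin_numE//; apply: (@le_lt_trans _ _ (S (maxn N N0.+1))).
    exact/S_nd/leq_maxl.
  by apply: le_lt_trans (SL _ _) (ltry _); exact: leq_maxr.
have efin t : e t \is a fin_num.
  rewrite ge0_fin_numE//; apply: (@le_lt_trans _ _ (S t.+1)).
    by rewrite /S big_nat_recr//=; apply: leeDr; exact: S0.
  by rewrite -ge0_fin_numE.
pose r t := fine (e t).
have Sr N : S N = (\sum_(0 <= t < N) r t)%:E.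
  by rewrite -sumEFin; apply: eq_bigr => t _; rewrite /r fineK.
have L0 : (0 <= L)%R.
  have := le_trans (S0 N0.+1) (SL _ (ltnSn N0)).
  by rewrite lee_fin pmulr_lge0// ltr0n.
(* This dominates all the partial sums that precede the eventual bound [S N <= L * N]. *)
pose C := fine (S N0.+1).
have C0 : (0 <= C)%R by rewrite /C fine_ge0.
have rCL N : (\sum_(0 <= t < N) r t <= C + L * N%:R)%R.
  rewrite -lee_fin -Sr EFinD /C fineK//.
  have [N0N|NN0] := ltnP N0 N.
    by apply: le_trans (SL N N0N) _; rewrite leeDr.
  apply: (@le_trans _ _ (S N0.+1)); first exact/S_nd/leqW.
  by rewrite leeDl// lee_fin mulr_ge0.
exists C => alpha /andP[a0 a1].
rewrite discounted_costE// -nneseriesZl; last first.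
  by move=> t _; rewrite mule_ge0// lee_fin exprn_ge0.
apply: lime_le.
  apply: is_cvg_nneseries => t _ _.
  by rewrite !mule_ge0// lee_fin ?exprn_ge0// subr_ge0 ltW.
apply: nearW => N.
have -> : \sum_(0 <= t < N) (1 - alpha)%:E * ((alpha ^+ t)%:E * e t) =
    ((1 - alpha) * \sum_(0 <= t < N) alpha ^+ t * r t)%:E.
  rewrite mulr_sumr -sumEFin; apply: eq_bigr => t _.
  by rewrite !EFinM /r fineK.
have a01 : (0 <= alpha <= 1)%R by rewrite a0 ltW.
have := abel_bound a01 rCL N; have := @geometric_sum_le _ alpha N.
rewrite a0 a1 => /(_ isT); rewrite lee_fin.
set G := (\sum_(0 <= t < N) alpha ^+ t)%R => aG rG.
apply: (@le_trans _ _ ((1 - alpha) * (C + L * G))%R).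
  by rewrite ler_wpM2l// subr_ge0 ltW.
by rewrite mulrDr lerD2l mulrCA -[leRHS]mulr1 ler_wpM2l.
Qed.

Lemma average_cost_le (R : realType) (dX dA : measure_display)
    (X : measurableMetricType R dX) (A : measurableMetricType R dA)
    (c : X * A -> \bar R) (q : R.-pker (X * A) ~> X)
    (pi : @policy R dX dA X A) (x : X) (rho b : R) :
  measurable_fun setT c -> (forall z, 0 <= c z) ->
  (forall N, \sum_(0 <= t < N) expected_cost c q pi x t <= (rho * N%:R + b)%:E) ->
  average_cost c q pi x <= rho%:E.
Proof.
move=> mc c0 Sb; apply/lee_addgt0Pr => e e0; apply: limn_esup_le.
near=> N; rewrite finite_horizon_costE//.
have N0 : (0 < N)%N by near: N; exact: nbhs_infty_gt.
rewrite lee_pdivrMl ?ltr0n//.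
under eq_bigr do rewrite expr1n mul1e.
apply: (le_trans (Sb N)); rewrite -EFinD -EFinM lee_fin mulrDr.
rewrite [(rho * _)%R]mulrC lerD2l.
have : (b / e <= N%:R)%R by near: N; exact: nbhs_infty_ger.
by rewrite ler_pdivrMr.
Unshelve. all: by end_near. Qed.

(* The upper half of the Vitali convergence theorem. *)
Lemma uniformly_integrable_upper_limit (R : realType) (d : measure_display)
    (X : measurableType d) (mu : {measure set X -> \bar R})
    (f_ : nat -> X -> \bar R) (f : X -> \bar R) :
  mu setT = 1 ->
  (forall n, measurable_fun setT (f_ n)) -> (forall n y, 0 <= f_ n y) ->
  measurable_fun setT f -> (forall y, 0 <= f y) ->
  (forall y, (f_ ^~ y) @ \oo --> f y) ->
  asymptotically_uniformly_integrable mu f_ ->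
  forall e : R, (0 < e)%R ->
    \forall n \near \oo, \int[mu]_y f_ n y <= \int[mu]_y f y + e%:E.
Proof.
move=> mu1 mf_ f_0 mf f0 f_f aui e e0.
have e20 : (0 < e / 2)%R by rewrite divr_gt0.
pose T (K : R) n := \int[mu]_y (`|f_ n y| * (\1_[set y | (K%:E <= `|f_ n y|)%E] y)%:E).
have [K [K0 TK]] : exists K : R, (0 <= K)%R /\ limn_esup (T K) < (e / 2)%:E.
  have h1 : \forall K \near +oo%R, limn_esup (T K) < (e / 2)%:E.
    have : nbhs (0 : \bar R) [set y | y < (e / 2)%:E].
      by apply: open_nbhs_nbhs; split; [exact: open_ereal_lt_ereal|rewrite /= lte_fin].
    exact: aui.
  have h2 : \forall K \near +oo%R, (0 <= K :> R)%R by exact: nbhs_pinfty_ge.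
  by have [K [? ?]] := filter_ex (filterI h1 h2); exists K.
have near1 := limn_esup_lt TK.
(* [f_ n] is at most its truncation at [K] plus the tail [T K n]. The integrals of the truncations
   converge by dominated convergence, and the tail is eventually below [e / 2]. *)
pose g_ n y := mine (f_ n y) K%:E.
pose g y := mine (f y) K%:E.
have mg_ n : measurable_fun setT (g_ n) by exact: measurable_mine.
have mg : measurable_fun setT g by exact: measurable_mine.
have g_0 n y : 0 <= g_ n y by rewrite le_min f_0 lee_fin.
have g0 y : 0 <= g y by rewrite le_min f0 lee_fin.
have g_K n y : `|g_ n y| <= K%:E by rewrite gee0_abs// ge_min lexx orbT.
have g_g y : g_ ^~ y @ \oo --> g y.
  move=> U; rewrite /g; have [fK|Kf|fK] := ltgtP (f y) K%:E => Uf.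
  - have nK : \forall n \near \oo, f_ n y < K%:E.
      apply: (f_f y [set z | z < K%:E]); apply: open_nbhs_nbhs.
      by split=> //; exact: open_ereal_lt_ereal.
    have nU : \forall n \near \oo, U (f_ n y) := f_f y U Uf.
    suff : \forall n \near \oo, U (g_ n y) by [].
    by apply: filterS2 nU nK => n Un nK; rewrite /g_ min_l// ltW.
  - have nK : \forall n \near \oo, K%:E < f_ n y.
      apply: (f_f y [set z | K%:E < z]); apply: open_nbhs_nbhs.
      by split=> //; exact: open_ereal_gt_ereal.
    suff : \forall n \near \oo, U (g_ n y) by [].
    apply: filterS nK => n nK; rewrite /g_ min_r ?ltW//; exact: nbhs_singleton.
  - have nU : \forall n \near \oo, U (f_ n y).
      by apply: (f_f y U); move: Uf; rewrite ?fK ?minxx.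
    suff : \forall n \near \oo, U (g_ n y) by [].
    apply: filterS nU => n Un; rewrite /g_ minEle; case: ifP => // _.
    by apply: nbhs_singleton; move: Uf; rewrite ?fK ?minxx.
have iK : mu.-integrable setT (cst K%:E).
  apply/integrableP; split; first exact: measurable_cst.
  under eq_integral do rewrite /= ger0_norm//.
  by rewrite integral_cst// [X in _ * X]mu1 mule1 ltry.
have [_ _ cvg_int] := @dominated_convergence _ _ _ mu setT measurableT g_ g
  (cst K%:E) mg_ mg (aeW _ (fun y _ => g_g y)) iK (aeW _ (fun y n _ => g_K n y)).
have gfin : \int[mu]_y g y \is a fin_num.
  rewrite ge0_fin_numE; last exact: integral_ge0.
  apply: (@le_lt_trans _ _ (\int[mu]_y cst K%:E y)).
    by apply: ge0_le_integral => // y _; rewrite ge_min lexx orbT.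
  by rewrite integral_cst// [X in _ * X]mu1 mule1 ltry.
have near2 : \forall n \near \oo, \int[mu]_y g_ n y < \int[mu]_y g y + (e / 2)%:E.
  have : nbhs (\int[mu]_y g y) [set z | z < \int[mu]_y g y + (e / 2)%:E].
    apply: open_nbhs_nbhs; split; first exact: open_ereal_lt_ereal.
    by rewrite /= lteDl// lte_fin.
  exact: cvg_int.
apply: filterS2 near1 near2 => n n1 n2.
have mT : measurable_fun setT
    (fun y => `|f_ n y| * (\1_[set y | (K%:E <= `|f_ n y|)%E] y)%:E).
  have mabs : measurable_fun setT (fun y => `|f_ n y|) by exact: measurableT_comp.
  apply: emeasurable_funM => //; apply/measurable_EFinP/measurable_indic.
  by rewrite -[X in measurable X]setTI; exact: emeasurable_fun_c_infty.
apply: (@le_trans _ _ (\int[mu]_y g_ n y + T K n)).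
  rewrite -ge0_integralD//.
  apply: ge0_le_integral => //; first exact: emeasurable_funD.
  move=> y _; rewrite /g_ gee0_abs// indicE.
  have [Kf|fK] := leP K%:E (f_ n y).
    rewrite mem_set//= ?gee0_abs// mule1; apply: leeDr.
    by first [exact: (g_0 n y)|rewrite lee_fin].
  rewrite memNset ?mule0 ?adde0//=.
  by rewrite gee0_abs//; apply/negP; rewrite -ltNge.
apply: (@le_trans _ _ (\int[mu]_y g y + (e / 2)%:E + (e / 2)%:E)).
  by apply: leeD; exact: ltW.
rewrite -addeA -EFinD -splitr leeD2r//; apply: ge0_le_integral => // y _.
by rewrite ge_min lexx.
Qed.

(** * Optimality equation for nonnegative costs *)

Section nonnegative_cost.
Context (R : realType) (dX dA : measure_display).
Context (X : measurableMetricType R dX) (A : measurableMetricType R dA).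
Variables (c : X * A -> \bar R) (q : R.-pker (X * A) ~> X).
Hypothesis X_borel : borel_subset_of_polish X.
Hypothesis A_borel : borel_subset_of_polish A.
Hypothesis mc : measurable_fun setT c.
Hypothesis c0 : forall z, 0 <= c z.
Hypothesis infc : K_inf_compact c.
Hypothesis wq : weakly_continuous q.
Hypothesis B_finite : optimal_average_cost c q < +oo.
Hypothesis B_bounded : forall x : X,
  ereal_sup [set relative_value c q alpha x
            | alpha in [set alpha : R | (0 <= alpha < 1)%R]] < +oo.
Variable alpha_ : nat -> R.
Hypothesis alpha_range : forall n, (0 <= alpha_ n < 1)%R.
Hypothesis alpha_nd : nondecreasing_seq alpha_.
Hypothesis alpha_cvg1 : alpha_ @ \oo --> (1 : R)%R.
(** Tied to the cost by an equation instead of a definition: after the cost shift, the hypotheses on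
    the relative values of the original cost apply unchanged. *)
Variable u_ : nat -> X -> \bar R.
Hypothesis u_def : forall n x, u_ n x = relative_value c q (alpha_ n) x.
Hypothesis u_equi : lower_semi_equicontinuous u_.
Hypothesis u_cvg : forall x : X, cvgn (u_ ^~ x).
Hypothesis u_ui : forall (x : X) (a : A),
  asymptotically_uniformly_integrable (q (x, a)) u_.

Let alpha0 n : (0 <= alpha_ n)%R. Proof. by have /andP[] := alpha_range n. Qed.
Let alpha1 n : (alpha_ n < 1)%R. Proof. by have /andP[] := alpha_range n. Qed.

Let v n := discounted_value c q (alpha_ n).
Let m n := fine (min_discounted_value c q (alpha_ n)).
Let rho n : R := ((1 - alpha_ n) * m n)%R.

Let v_ge0 n x : 0 <= v n x.
Proof. exact: discounted_value_ge0. Qed.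

Let min_ge0 n : 0 <= min_discounted_value c q (alpha_ n).
Proof. by apply: le_ereal_inf_tmp => _ [x _ <-]; exact: v_ge0. Qed.

Let finite_average : exists x pi (L : R), average_cost c q pi x < L%:E.
Proof.
move: B_finite => /ereal_inf_lt[_ [x _ <-] /ereal_inf_lt[_ [pi _ <-] avg]].
exists x, pi; move: avg; case: average_cost => [r||]// _.
- by exists (r + 1)%R; rewrite lte_fin ltrDl.
- by exists 0%R; rewrite ltNyr.
Qed.

(** By [B_finite] some policy has finite average cost; the Abelian inequality makes its discounted
    cost finite for every factor below 1. *)
Let minE n : (m n)%:E = min_discounted_value c q (alpha_ n).
Proof.
rewrite fineK// ge0_fin_numE//.
have [x [pi [L /(discounted_cost_average mc c0)[C /(_ _ (alpha_range n))]]]] :=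
  finite_average.
move=> h; apply: (@le_lt_trans _ _ (discounted_cost c q (alpha_ n) pi x)).
  apply: (@le_trans _ _ (v n x)); apply: ereal_inf_lbound; first by exists x.
  by exists pi.
rewrite -lee_pdivlMl ?subr_gt0// in h.
by apply: le_lt_trans h _; rewrite -EFinM ltry.
Qed.

Let m_le n x : (m n)%:E <= v n x.
Proof. by rewrite minE; apply: ereal_inf_lbound; exists x. Qed.

Let m_ge0 n : (0 <= m n)%R.
Proof. by rewrite -lee_fin minE. Qed.

Let uE n x : u_ n x = v n x - (m n)%:E.
Proof. by rewrite u_def minE. Qed.

Let vE n x : v n x = u_ n x + (m n)%:E.
Proof. by rewrite uE subeK. Qed.

Let u_ge0 n x : 0 <= u_ n x.
Proof. by rewrite uE sube_ge0. Qed.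

Let u_bounded n x : u_ n x <=
  ereal_sup [set relative_value c q alpha x
            | alpha in [set alpha : R | (0 <= alpha < 1)%R]].
Proof.
by rewrite u_def; apply: ereal_sup_ubound; exists (alpha_ n) => //=; exact: alpha_range.
Qed.

Let u_fin n x : u_ n x \is a fin_num.
Proof. by rewrite ge0_fin_numE//; exact: le_lt_trans (u_bounded n x) (B_bounded x). Qed.

Let lv n : lower_semicontinuous (v n).
Proof. exact: lower_semicontinuous_discounted_value. Qed.

Let mu_ n : measurable_fun setT (u_ n).
Proof.
rewrite (_ : u_ n = fun x => v n x - (m n)%:E); last by apply/funext => x; rewrite uE.
apply: emeasurable_funB => //.
exact: (lower_semicontinuous_borel X_borel.1 (@lv n)).
Qed.

Let u x := limn_einf (u_ ^~ x).

Let u_lim x : u_ ^~ x @ \oo --> u x.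
Proof. by rewrite /u is_cvg_limn_einfE//; exact: u_cvg. Qed.

Let u0 x : 0 <= u x.
Proof. by apply: cvge_ge (@u_lim x); exact: nearW. Qed.

Let ufin x : u x \is a fin_num.
Proof.
rewrite ge0_fin_numE; last exact: u0.
apply: (@le_lt_trans _ _ _ _ _ _ (B_bounded x)).
by apply: cvge_le (@u_lim x); apply: nearW => n; exact: u_bounded.
Qed.

Let I_ j x := ereal_inf [set u_ n x | n in [set n | (j <= n)%N]].

Let lI j : lower_semicontinuous (I_ j).
Proof. exact: lower_semicontinuous_equi_inf. Qed.

Let I_ge0 j x : 0 <= I_ j x.
Proof. by apply: le_ereal_inf_tmp => _ [n _ <-]. Qed.

Let I_le j n x : (j <= n)%N -> I_ j x <= u_ n x.
Proof. by move=> jn; apply: ereal_inf_lbound; exists n. Qed.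

Let I_nd x j k : (j <= k)%N -> I_ j x <= I_ k x.
Proof.
move=> jk; apply: le_ereal_inf_tmp => _ [n kn <-].
by apply: I_le; exact: leq_trans jk kn.
Qed.

Let I_sup x : ereal_sup (range (I_ ^~ x)) = u x.
Proof.
rewrite /u limn_einf_lim; apply/esym/cvg_lim => //.
exact: (ereal_nondecreasing_cvgn (@I_nd x)).
Qed.

Let lu : lower_semicontinuous u.
Proof.
rewrite (_ : u = fun x => ereal_sup (range (I_ ^~ x))).
  exact: lower_semicontinuous_sup.
by apply/funext => x; rewrite I_sup.
Qed.

Let mu : measurable_fun setT u.
Proof. exact: (lower_semicontinuous_borel X_borel.1 lu). Qed.

(** With the discount factor inside, the minorants still increase to [u], as [alpha_] is
    nondecreasing, and they lie below [alpha_ n * u_ n], the integrand of the discounted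
    equation. *)
Let U_ j x := (alpha_ j)%:E * I_ j x.

Let lU j : lower_semicontinuous (U_ j).
Proof. exact: lower_semicontinuousZ. Qed.

Let U_ge0 j x : 0 <= U_ j x.
Proof. by rewrite mule_ge0// lee_fin. Qed.

Let U_nd x : {homo (U_ ^~ x) : j k / (j <= k)%N >-> j <= k}.
Proof.
move=> j k jk; apply: lee_pmul => //; rewrite ?lee_fin//; last exact: I_nd.
exact: alpha_nd.
Qed.

Let U_sup x : ereal_sup (range (U_ ^~ x)) = u x.
Proof.
have cvgU : U_ ^~ x @ \oo --> 1%:E * u x.
  apply: cvgeM.
  - by rewrite mule_def_fin.
  - by apply/fine_cvgP; split; [exact: nearW|exact: alpha_cvg1].
  - by rewrite -I_sup; exact: (ereal_nondecreasing_cvgn (@I_nd x)).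
rewrite mul1e in cvgU; apply: cvg_unique cvgU => //.
exact: (ereal_nondecreasing_cvgn (@U_nd x)).
Qed.

Let U_le j n x : (j <= n)%N -> U_ j x <= (alpha_ n)%:E * u_ n x.
Proof.
move=> jn; apply: lee_pmul => //; rewrite ?lee_fin//; last exact: I_le.
exact: alpha_nd.
Qed.

Let action_cost_value n x a :
  action_cost c q (fun y => (alpha_ n)%:E * v n y) (x, a) =
  action_cost c q (fun y => (alpha_ n)%:E * u_ n y) (x, a) +
  (alpha_ n * m n)%:E.
Proof.
rewrite /action_cost -addeA; congr (_ + _).
rewrite -[X in _ + X](integral_kernel_cst q (x, a)) -ge0_integralD//.
- by apply: eq_integral => y _; rewrite vE ge0_muleDr// lee_fin.
- by move=> y _; rewrite mule_ge0// lee_fin.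
- exact/measurable_funeM/mu_.
- by move=> y _; rewrite lee_fin mulr_ge0.
Qed.

Let discounted_ineq n x a : (rho n)%:E + u_ n x <=
  action_cost c q (fun y => (alpha_ n)%:E * u_ n y) (x, a).
Proof.
have : v n x <= action_cost c q (fun y => (alpha_ n)%:E * v n y) (x, a).
  by rewrite [leLHS]discounted_value_bellman//; exact: bellman_le.
rewrite action_cost_value -leeBlDr// vE; apply: le_trans.
rewrite -(fineK (u_fin n x)) -!EFinD lee_fin /rho; lra.
Qed.

Let discounted_attained n x : exists a,
  action_cost c q (fun y => (alpha_ n)%:E * u_ n y) (x, a) <= (rho n)%:E + u_ n x.
Proof.
have av0 y : 0 <= (alpha_ n)%:E * v n y by rewrite mule_ge0// lee_fin.
have lav : lower_semicontinuous (fun y => (alpha_ n)%:E * v n y).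
  exact: lower_semicontinuousZ.
have [phi [_ /(_ x) phiP]] := bellman_selector X_borel A_borel infc wq c0 av0 lav.
exists (phi x); rewrite action_cost_value in phiP.
rewrite -[RHS]discounted_value_bellman// -/(v n x) vE in phiP.
have : action_cost c q (fun y => (alpha_ n)%:E * u_ n y) (x, phi x) <=
    u_ n x + (m n)%:E - (alpha_ n * m n)%:E by rewrite leeBrDr// phiP.
move=> /le_trans; apply.
rewrite -(fineK (u_fin n x)) -!EFinD lee_fin /rho; lra.
Qed.

(** Serves twice: a policy of finite average cost bounds [rho], and in the limit, where the term
    with [C] vanishes, every average cost is seen to be at least [r]. *)
Let rho_le x pi (L : R) : average_cost c q pi x < L%:E ->
  exists C, forall n, (rho n <= (1 - alpha_ n) * C + L)%R.
Proof.
move=> /(discounted_cost_average mc c0)[C CL]; exists C => n.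
rewrite -lee_fin; apply: le_trans (CL _ (alpha_range n)).
rewrite /rho EFinM; apply: lee_wpmul2l; first by rewrite lee_fin subr_ge0 ltW.
apply: le_trans (m_le n x) _; apply: ereal_inf_lbound; by exists pi.
Qed.

Let rho_ge0 n : (0 <= rho n)%R.
Proof. by rewrite mulr_ge0// subr_ge0 ltW. Qed.

Let rho_subsequence : exists (r : R) (n_ : nat -> nat),
  (forall k, (k <= n_ k)%N) /\ (rho \o n_) @ \oo --> r.
Proof.
have [x [pi [L /rho_le[C rhoC]]]] := finite_average.
have [n|r [_ [n_ [kn rho_r]]]] := @compact_subsequence R R `[0%R, (`|C| + L)%R]%classic
  rho (@segment_compact R 0 (`|C| + L)%R).
  rewrite /= in_itv/= rho_ge0/=; apply: (le_trans (rhoC n)); rewrite lerD2r.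
  have := ler_norm C; have := normr_ge0 C; have := alpha0 n; have := alpha1 n; nra.
by exists r, n_.
Qed.

Section along_subsequence.
Variables (r : R) (n_ : nat -> nat).
Hypothesis kn : forall k, (k <= n_ k)%N.
Hypothesis rho_r : (rho \o n_) @ \oo --> r.

Let rho_rE : (fun k => (rho (n_ k))%:E) @ \oo --> r%:E.
Proof. by apply/fine_cvgP; split; [exact: nearW|exact: rho_r]. Qed.

Let u_sub x : (fun k => u_ (n_ k) x) @ \oo --> u x.
Proof. exact: cvg_comp (cvgn_subsequence kn) (@u_lim x). Qed.

Let r0 : (0 <= r)%R.
Proof.
by rewrite -lee_fin; apply: cvge_ge rho_rE; apply: nearW => k; rewrite lee_fin.
Qed.

Lemma optimality_inequality x a : r%:E + u x <= action_cost c q u (x, a).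
Proof.
apply/lee_addgt0Pr => e e0.
have [N _ uiN] := uniformly_integrable_upper_limit
  (@prob_kernel _ _ _ _ _ q (x, a)) mu_ u_ge0 mu u0
  (fun y => @u_lim y) (@u_ui x a) e0.
have cvg_l : (fun k => (rho (n_ k))%:E + u_ (n_ k) x) @ \oo --> r%:E + u x.
  by apply: cvgeD.
apply: cvge_le cvg_l; near=> k.
apply: le_trans (discounted_ineq (n_ k) x a) _.
rewrite /action_cost -addeA leeD2l//.
apply: (@le_trans _ _ (\int[q (x, a)]_y u_ (n_ k) y)).
  apply: ge0_le_integral => //.
  - by move=> y _; rewrite mule_ge0// lee_fin.
  - exact/measurable_funeM/mu_.
  - by move=> y _; rewrite gee_pMl// lee_fin ltW.
apply: (uiN (n_ k)); rewrite /=; apply: leq_trans (kn k).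
by near: k; exact: nbhs_infty_ge.
Unshelve. all: by end_near. Qed.

Lemma optimality_attained x : exists a, action_cost c q u (x, a) <= r%:E + u x.
Proof.
have /choice[a aP] := fun k => discounted_attained (n_ k) x.
pose l_ k := (rho (n_ k) + fine (u_ (n_ k) x))%R.
have l_cvg : l_ @ \oo --> (r + fine (u x))%R.
  apply: cvgD; first exact: rho_r.
  apply: fine_cvg; rewrite fineK; last exact: ufin.
  exact: u_sub.
have [|k j jk|b [bl _]] := @inf_compact_limit R dX dA X A q X_borel.1 wq c infc c0
  (fun=> x) a x U_ l_ _ (cvg_cst _) l_cvg (@lU) U_ge0.
- exact: U_nd.
- rewrite /l_ EFinD fineK//; apply: le_trans (aP k).
  rewrite /action_cost leeD2l//; apply: ge0_le_integral => //.
  + exact: (lower_semicontinuous_borel X_borel.1 (@lU j)).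
  + exact/measurable_funeM/mu_.
  + by move=> y _; apply: U_le; exact: leq_trans jk (kn k).
exists b; rewrite EFinD fineK in bl; last exact: ufin.
apply: le_trans bl; rewrite /action_cost leeD2l//.
by under [leRHS]eq_integral do rewrite U_sup.
Qed.

Lemma optimality_equation x : bellman c q u x = r%:E + u x.
Proof.
apply/eqP; rewrite eq_le; apply/andP; split.
  by have [a /(le_trans (bellman_le _ _ _ _ a))] := optimality_attained x.
by apply: le_ereal_inf_tmp => _ [a _ <-]; exact: optimality_inequality.
Qed.

(** Along [phi] the equation telescopes to [r * N + u x], equal to the expected cost of [N] stages
    plus [E N]. Dropping [E N >= 0] leaves the excess [u x], which disappears on division by [N].
    Only additions are used, so no [E n] has to be shown finite beforehand. *)
Lemma stationary_average_cost_le (phi : X -> A) (mphi : measurable_fun setT phi) x :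
  (forall y, action_cost c q u (y, phi y) = r%:E + u y) ->
  average_cost c q (stationary_policy mphi) x <= r%:E.
Proof.
move=> phiP; set pi := stationary_policy mphi.
apply: (@average_cost_le _ _ _ _ _ _ _ _ _ _ (fine (u x))) => // N.
rewrite EFinD fineK; last exact: ufin.
have mru : measurable_fun setT (fun y => r%:E + u y) by exact: emeasurable_funD.
have ru0 y : 0 <= r%:E + u y by rewrite adde_ge0// lee_fin.
pose E n := \int[strategic_measure q pi x]_w u (w n).1.
have E0 n : 0 <= E n by exact: integral_ge0.
have step n : r%:E + E n = expected_cost c q pi x n + E n.+1.
  rewrite -(@expected_value_stationary _ _ _ X A c q mc c0 pi x
    (fun y => r%:E + u y) u mu u0 n phi mphi)//.
  have mun := measurableT_comp mu (@measurable_state _ _ _ X A n).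
  rewrite (@ge0_integralD _ _ _ _ setT measurableT (cst r%:E)
    (fun w : trajectory (X * A)%type => u (w n).1))//.
  congr (_ + _); apply/esym; exact: integral_probability_cst.
have sumE n : (r * n%:R)%:E + u x =
    \sum_(0 <= t < n) expected_cost c q pi x t + E n.
  elim: n => [|n IHn].
    by rewrite big_geq// mulr0 !add0e /E integral_initial_state.
  rewrite big_nat_recr; last by [].
  rewrite -addeA -(step n).
  rewrite addeCA.
  rewrite -IHn addeA.
  congr (_ + _).
  by rewrite -EFinD -natr1 mulrDr mulr1 addrC.
by rewrite sumE leeDl.
Qed.

(** In particular [r] does not depend on the subsequence. A policy cheaper than [r] would have
    average cost below some [L < r], and [rho_le] would then force the limit of [rho] below [L] or
    onto it. *)
Lemma optimal_average_costE : optimal_average_cost c q = r%:E.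
Proof.
apply/eqP; rewrite eq_le; apply/andP; split.
  have [phi [mphi phiP]] := bellman_selector X_borel A_borel infc wq c0 u0 lu.
  have phiE y : action_cost c q u (y, phi y) = r%:E + u y.
    by rewrite phiP optimality_equation.
  have := stationary_average_cost_le mphi point phiE; apply: le_trans.
  apply: (@le_trans _ _ (average_value c q point)); apply: ereal_inf_lbound.
    by exists point.
  by exists (stationary_policy mphi).
rewrite leNgt; apply/negP => /ereal_inf_lt[_ [x _ <-] /ereal_inf_lt[_ [pi _ <-] avg]].
have [L avgL Lr] : exists2 L : R, average_cost c q pi x < L%:E & (L < r)%R.
  case: average_cost avg => [s||]//; last by exists (r - 1)%R; rewrite ?ltNyr// gtrBl.
  by rewrite lte_fin => sr; exists ((s + r) / 2)%R; rewrite ?lte_fin; lra.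
have [C rhoC] := rho_le avgL.
suff : (r <= L)%R by rewrite leNgt Lr.
have cvgL : (fun k => (1 - alpha_ (n_ k)) * C + L)%R @ \oo -->
    ((1 - 1) * C + L)%R.
  apply: cvgD; last exact: cvg_cst.
  apply: cvgM; last exact: cvg_cst.
  apply: cvgB; first exact: cvg_cst.
  exact: cvg_comp (cvgn_subsequence kn) alpha_cvg1.
rewrite subrr mul0r add0r in cvgL.
rewrite -(cvg_lim _ cvgL)// -(cvg_lim _ rho_r)//.
apply: ler_lim; [exact: cvgP rho_r|exact: cvgP cvgL|].
by apply: nearW => k; exact: rhoC.
Qed.

End along_subsequence.

Lemma acoe_nonnegative : exists phi : X -> A, measurable_fun setT phi /\
  forall x : X,
    optimal_average_cost c q + u x = c (x, phi x) + \int[q (x, phi x)]_y u y /\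
    (forall a : A, c (x, phi x) + \int[q (x, phi x)]_y u y
                   <= c (x, a) + \int[q (x, a)]_y u y).
Proof.
have [r [n_ [kn rho_r]]] := rho_subsequence.
have [phi [mphi phiP]] := bellman_selector X_borel A_borel infc wq c0 u0 lu.
exists phi; split=> // x; split.
  rewrite (optimal_average_costE kn rho_r) -(optimality_equation kn rho_r).
  exact/esym/phiP.
by move=> a; rewrite -/(action_cost c q u (x, phi x)) phiP; exact: bellman_le.
Qed.

End nonnegative_cost.

(** * Reduction to nonnegative costs *)

(** For negative [K] the sum changes sign and additivity for nonnegative functions does not apply
    directly. The negative part of [g] is at most [- K], hence has finite integral, and
    [f + g^- = g^+ - K] relates nonnegative functions only. *)
Lemma integral_probability_shift (R : realType) (d : measure_display)
    (T : measurableType d) (P : probability T R) (f : T -> \bar R) (K : R) :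
  measurable_fun setT f -> (forall x, 0 <= f x) ->
  \int[P]_x (f x + K%:E) = \int[P]_x f x + K%:E.
Proof.
move=> mf f0; have [K0|K0] := leP 0%R K.
  rewrite (@ge0_integralD _ _ _ _ setT measurableT f (cst K%:E))//.
  by congr (_ + _); exact: integral_probability_cst.
pose g x := f x + K%:E.
have mg : measurable_fun setT g by exact: emeasurable_funD.
have K0' : (0 <= - K)%R by rewrite oppr_ge0 ltW.
have gneg x : g^\- x <= (- K)%:E.
  rewrite funenegE ge_max lee_fin K0' andbT EFinN leeN2.
  exact: leeDr.
have fg x : f x + g^\- x = g^\+ x + (- K)%:E.
  have gfin : g^\- x \is a fin_num.
    by rewrite ge0_fin_numE ?(le_lt_trans (gneg x)) ?ltry.
  have -> : f x = g^\+ x - g^\- x + (- K)%:E.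
    rewrite -[X in _ = X + _](congr1 (fun h => h x) (funeposneg g)).
    by rewrite /g -addeA -EFinD subrr adde0.
  by rewrite addeAC subeK.
have gneg_fin : \int[P]_x g^\- x \is a fin_num.
  rewrite ge0_fin_numE; last by exact: integral_ge0.
  apply: (@le_lt_trans _ _ (\int[P]_x (- K)%:E)).
    apply: ge0_le_integral => //; exact: measurable_funeneg.
  by rewrite integral_probability_cst ltry.
have fgint : \int[P]_x f x + \int[P]_x g^\- x = \int[P]_x g^\+ x + (- K)%:E.
  rewrite -ge0_integralD//; last exact: measurable_funeneg.
  rewrite (eq_integral _ _ (fun x _ => fg x)).
  rewrite (@ge0_integralD _ _ _ _ setT measurableT g^\+ (cst (- K)%:E))//.
    by congr (_ + _); exact: integral_probability_cst.
  exact: measurable_funepos.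
rewrite integralE -/g.
have -> : \int[P]_x g^\+ x = \int[P]_x f x + \int[P]_x g^\- x + K%:E.
  by rewrite fgint -addeA -EFinD addNr adde0.
by rewrite addeAC addeK.
Qed.

Lemma ereal_inf_shift (R : realType) (T : Type) (F : T -> \bar R) (K : R) :
  ereal_inf (range (fun i => F i + K%:E)) = ereal_inf (range F) + K%:E.
Proof.
apply/eqP; rewrite eq_le; apply/andP; split.
  rewrite -leeBlDr//; apply: le_ereal_inf_tmp => _ [i _ <-].
  by rewrite leeBlDr//; apply: ereal_inf_lbound; exists i.
apply: le_ereal_inf_tmp => _ [i _ <-]; rewrite leeD2r//.
by apply: ereal_inf_lbound; exists i.
Qed.

Lemma limn_esup_shift_le (R : realType) (f g : nat -> \bar R) (K : R) :
  (\forall n \near \oo, g n <= f n + K%:E) ->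
  limn_esup g <= limn_esup f + K%:E.
Proof.
move=> gf; rewrite -leeBlDr//; apply: le_ereal_inf_tmp => _ [V VN <-].
rewrite leeBlDr//; apply: limn_esup_le; apply: filterS2 gf VN => n gfn Vn.
by apply: le_trans gfn _; rewrite leeD2r//; apply: ereal_sup_ubound; exists n.
Qed.

Lemma limn_esup_shift (R : realType) (f g : nat -> \bar R) (K : R) :
  (\forall n \near \oo, g n = f n + K%:E) -> limn_esup g = limn_esup f + K%:E.
Proof.
move=> gf; apply/eqP; rewrite eq_le; apply/andP; split.
  by apply: limn_esup_shift_le; apply: filterS gf => n ->.
rewrite -leeBrDr// -EFinN; apply: limn_esup_shift_le.
by apply: filterS gf => n ->; rewrite EFinN addeK.
Qed.

Section cost_shift.
Context (R : realType) (dX dA : measure_display).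
Context (X : measurableMetricType R dX) (A : measurableMetricType R dA).
Variables (c : X * A -> \bar R) (q : R.-pker (X * A) ~> X) (M : R).
Hypothesis mc : measurable_fun setT c.
Hypothesis cM : forall z, M%:E <= c z.
Local Notation Om := (trajectory (X * A)%type).

Let c' z := c z - M%:E.

Let cE z : c z = c' z + M%:E.
Proof. by rewrite /c' subeK. Qed.

Lemma shifted_cost_ge0 z : 0 <= c' z.
Proof. by rewrite /c' sube_ge0. Qed.

Lemma measurable_shifted_cost : measurable_fun setT c'.
Proof. exact: emeasurable_funB. Qed.

Lemma shifted_cost_inf_compact : K_inf_compact c -> K_inf_compact c'.
Proof.
move=> infc K K0 cK l.
rewrite (_ : [set xa | _] = [set xa | K xa.1 /\ c xa <= (l + M)%:E]).
  exact: infc.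
by apply/seteqP; split=> z /=; rewrite /c' EFinD leeBlDr.
Qed.

Let weighted alpha t (w : Om) : (0 <= alpha)%R ->
  (alpha ^+ t)%:E * c (w t) = (alpha ^+ t)%:E * c' (w t) + (alpha ^+ t * M)%:E.
Proof. by move=> a0; rewrite cE muleDr// fin_num_adde_defl. Qed.

Let partial_sum alpha N (w : Om) : (0 <= alpha)%R ->
  \sum_(0 <= t < N) (alpha ^+ t)%:E * c (w t) =
  \sum_(0 <= t < N) (alpha ^+ t)%:E * c' (w t) +
  (\sum_(0 <= t < N) alpha ^+ t * M)%:E.
Proof.
move=> a0; rewrite -sumEFin -big_split /=.
by apply: eq_bigr => t _; exact: weighted.
Qed.

Let weighted_ge0 alpha t (w : Om) : (0 <= alpha)%R ->
  0 <= (alpha ^+ t)%:E * c' (w t).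
Proof.
by move=> a0; rewrite mule_ge0// ?lee_fin ?exprn_ge0// shifted_cost_ge0.
Qed.

Let measurable_weighted alpha t :
  measurable_fun setT (fun w : Om => (alpha ^+ t)%:E * c' (w t)).
Proof.
apply: measurable_funeM.
exact: measurableT_comp measurable_shifted_cost (@measurable_coordinate _ (X * A)%type t).
Qed.

Lemma finite_horizon_cost_shift N pi x :
  finite_horizon_cost c q N 1%R pi x =
  finite_horizon_cost c' q N 1%R pi x + (N%:R * M)%:E.
Proof.
rewrite /finite_horizon_cost.
have -> : (N%:R * M = \sum_(0 <= t < N) 1 ^+ t * M)%R.
  under eq_bigr do rewrite expr1n mul1r.
  by rewrite sumr_const_nat subn0 mulr_natl.
rewrite -integral_probability_shift.
- by apply: eq_integral => w _; exact: partial_sum.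
- by apply: emeasurable_sum => t; exact: measurable_weighted.
- by move=> w; apply: sume_ge0 => t _; exact: weighted_ge0.
Qed.

Lemma average_value_shift x : average_value c q x = average_value c' q x + M%:E.
Proof.
rewrite /average_value -ereal_inf_shift; congr (ereal_inf _).
(* At [N = 0] both averages are 0 and the shift by [M] fails, so the identity is claimed for large
   [N] only. *)
apply: eq_imagel => pi _; apply: limn_esup_shift; near=> N.
have N0 : (0 < N)%N by near: N; exact: nbhs_infty_gt.
rewrite finite_horizon_cost_shift muleDr ?fin_num_adde_defl// -EFinM mulrA.
by rewrite mulVf ?mul1r// pnatr_eq0 -lt0n.
Unshelve. all: by end_near. Qed.

Lemma optimal_average_cost_shift :
  optimal_average_cost c q = optimal_average_cost c' q + M%:E.
Proof.
rewrite /optimal_average_cost -ereal_inf_shift; congr (ereal_inf _).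
by apply: eq_imagel => x _; exact: average_value_shift.
Qed.

Lemma discounted_cost_shift alpha pi x : (0 <= alpha < 1)%R ->
  discounted_cost c q alpha pi x =
  discounted_cost c' q alpha pi x + (M / (1 - alpha))%:E.
Proof.
move=> /andP[a0 a1]; rewrite /discounted_cost -integral_probability_shift.
- apply: eq_integral => w _.
  have cvg' : cvgn (fun N => \sum_(0 <= t < N) (alpha ^+ t)%:E * c' (w t)).
    by apply: is_cvg_nneseries => t _ _; exact: weighted_ge0.
  have cvgG : (fun N => (\sum_(0 <= t < N) alpha ^+ t * M)%:E) @ \oo -->
      (M / (1 - alpha))%:E.
    apply/fine_cvgP; split; first exact: nearW.
    rewrite (_ : fine \o _ = series (geometric M alpha)).
      by apply: cvg_geometric_series; rewrite ger0_norm.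
    apply/funext => N; rewrite /series/=.
    by apply: eq_bigr => t _; rewrite mulrC.
  rewrite (_ : (fun N => _) = (fun N => \sum_(0 <= t < N) (alpha ^+ t)%:E * c' (w t) +
      (\sum_(0 <= t < N) alpha ^+ t * M)%:E)); last first.
    by apply/funext => N; exact: partial_sum.
  rewrite limeD//.
  + by rewrite (cvg_lim _ cvgG).
  + exact: cvgP cvgG.
  + by rewrite (cvg_lim _ cvgG)// fin_num_adde_defl.
- apply: ge0_emeasurable_sum => [t w _ _|t _]; first exact: weighted_ge0.
  exact: measurable_weighted.
- by move=> w; apply: nneseries_ge0 => t _ _; exact: weighted_ge0.
Qed.

Lemma discounted_value_shift alpha x : (0 <= alpha < 1)%R ->
  discounted_value c q alpha x =
  discounted_value c' q alpha x + (M / (1 - alpha))%:E.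
Proof.
move=> a01; rewrite /discounted_value -ereal_inf_shift.
by congr (ereal_inf _); apply: eq_imagel => pi _; exact: discounted_cost_shift.
Qed.

Lemma relative_value_shift alpha x : (0 <= alpha < 1)%R ->
  relative_value c q alpha x = relative_value c' q alpha x.
Proof.
move=> a01.
have min_shift : min_discounted_value c q alpha =
    min_discounted_value c' q alpha + (M / (1 - alpha))%:E.
  rewrite /min_discounted_value -ereal_inf_shift; congr (ereal_inf _).
  by apply: eq_imagel => y _; exact: discounted_value_shift.
rewrite /relative_value (discounted_value_shift x a01) min_shift.
(* Neither value is known to be finite here, so the cancellation of the shift is checked case by
   case in the extended reals. *)
move: (discounted_value c' q alpha x) (min_discounted_value c' q alpha).
move=> [r||] [s||]//=; rewrite -!EFinD; congr (_%:E); lra.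
Qed.

End cost_shift.

(** * The optimality equation for costs bounded below *)

Unset Implicit Arguments.

Theorem theorem7p5 (R : realType) (dX dA : measure_display)
  (X : measurableMetricType R dX) (A : measurableMetricType R dA)
  (c : X * A -> \bar R) (q : R.-pker (X * A) ~> X)
  (X_borel : borel_subset_of_polish X)
  (A_borel : borel_subset_of_polish A)
  (c_measurable : measurable_fun setT c)
  (c_bounded_below : exists M : R, forall xa : X * A, M%:E <= c xa)
  (* Assumption W* *)
  (W_inf_compact : K_inf_compact c)
  (W_weakly_continuous : weakly_continuous q)
  (* Assumption B *)
  (B_finite : optimal_average_cost c q < +oo)
  (B_bounded : forall x : X,
     ereal_sup [set relative_value c q alpha x
                | alpha in [set alpha : R | (0 <= alpha < 1)%R]] < +oo)
  (alpha_ : nat -> R)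
  (alpha_range : forall n, (0 <= alpha_ n < 1)%R)
  (alpha_nondecreasing : nondecreasing_seq alpha_)
  (alpha_cvg1 : alpha_ @ \oo --> (1 : R)%R)
  (u_equicontinuous :
     lower_semi_equicontinuous (fun n => relative_value c q (alpha_ n)))
  (u_cvg : forall x : X, cvgn (fun n => relative_value c q (alpha_ n) x))
  (u_integrable : forall (x : X) (a : A),
     asymptotically_uniformly_integrable (q (x, a))
       (fun n => relative_value c q (alpha_ n))) :
  let u := fun x : X => limn_einf (fun n => relative_value c q (alpha_ n) x) in
  exists phi : X -> A, measurable_fun setT phi /\
    forall x : X,
      optimal_average_cost c q + u x
        = c (x, phi x) + \int[q (x, phi x)]_y u y /\
      (forall a : A, c (x, phi x) + \int[q (x, phi x)]_y u y
                     <= c (x, a) + \int[q (x, a)]_y u y).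
Proof.
move=> u; have [M cM] := c_bounded_below.
pose c' z := c z - M%:E.
have uE alpha x : (0 <= alpha < 1)%R ->
    relative_value c q alpha x = relative_value c' q alpha x.
  exact: relative_value_shift.
have w_shift : optimal_average_cost c q = optimal_average_cost c' q + M%:E.
  exact: optimal_average_cost_shift.
have lt_shift (y : \bar R) : y + M%:E < +oo -> y < +oo.
  by case: y => [r||]//; rewrite !ltry.
have w'_finite : optimal_average_cost c' q < +oo.
  by apply: lt_shift; rewrite -w_shift; exact: B_finite.
have u'_bounded (x : X) : ereal_sup [set relative_value c' q alpha x
    | alpha in [set alpha : R | (0 <= alpha < 1)%R]] < +oo.
  have -> : [set relative_value c' q alpha x
      | alpha in [set alpha : R | (0 <= alpha < 1)%R]] =
    [set relative_value c q alpha x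
      | alpha in [set alpha : R | (0 <= alpha < 1)%R]].
    by apply: eq_imagel => alpha a01; rewrite uE.
  exact: B_bounded.
have unE n x : relative_value c q (alpha_ n) x = relative_value c' q (alpha_ n) x.
  by apply: uE; exact: alpha_range.
have mc' : measurable_fun setT c' by exact: measurable_shifted_cost.
have c'0 z : 0 <= c' z by exact: shifted_cost_ge0.
have infc' : K_inf_compact c' by exact: shifted_cost_inf_compact.
have [phi [mphi phiP]] := @acoe_nonnegative R dX dA X A c' q X_borel A_borel
  mc' c'0 infc' W_weakly_continuous w'_finite u'_bounded alpha_
  alpha_range alpha_nondecreasing alpha_cvg1
  (fun n => relative_value c q (alpha_ n)) unE u_equicontinuous u_cvg u_integrable.
have cE z : c z = c' z + M%:E by rewrite /c' subeK.
exists phi; split; first exact: mphi.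
move=> x; have [eq_phi le_phi] := phiP x; split.
  rewrite w_shift (cE (x, phi x)) [LHS]addeAC [RHS]addeAC.
  exact: (congr1 (fun y => y + M%:E) eq_phi).
move=> a; rewrite (cE (x, phi x)) (cE (x, a)) [leLHS]addeAC [leRHS]addeAC.
exact: leeD2r (le_phi a).
Qed.
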